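(* Let $K$ be an algebraically closed field and let $d,n$ be integers with $1<d<n$, $\gcd(n,d)=1$ and $\operatorname{char}(K)\nmid d$. Let $m>n$ be an integer and $\ell:=m/d$. (a) If $m=d\cdot\lfloor (n+d)/d\rfloor$ is $(n,d)$-reachable over $K$, then $n-m+m/d=n-(d-1)\lfloor (n+d)/d\rfloor\geq 0$. (b) Suppose $d\mid m$ and $n-m+\ell\geq 0$, and suppose that $\operatorname{char}(K)=0$, or that $\operatorname{char}(K)=p>0$ with $p\nmid \ell$ in case $n-m+\ell=0$ and $p\nmid (n-m+\ell)$ in case $n-m+\ell>0$. Then $m$ is $(n,d)$-reachable over $K$.
   Context: For a polynomial $f(x)\in K[x]$ of degree $n$ without repeated roots, $\mathcal{C}_{f,d}$ denotes the smooth projective model of the affine curve $y^d=f(x)$; it has a unique point at infinity $O$. $\mathcal{C}_{f,d}$ is identified with its image in its Jacobian $J(\mathcal{C}_{f,d})$ via $Q\mapsto \operatorname{cl}((Q)-(O))$ (linear equivalence class), and a point $Q\in\mathcal{C}_{f,d}(K)$ has order $m$ if $\operatorname{cl}((Q)-(O))$ has order $m$ in $J(\mathcal{C}_{f,d})(K)$. An integer $m>1$ is called $(n,d)$-reachable over $K$ if there exists a monic polynomial $f(x)\in K[x]$ of degree $n$ without repeated roots such that $\mathcal{C}_{f,d}(K)$ contains a point of order $m$. *)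

(* Defs.v *)
From HB Require Import structures.
From mathcomp Require Import all_boot all_order all_algebra fraction.
From Stdlib Require Import ClassicalEpsilon.
Set Implicit Arguments. Unset Strict Implicit. Unset Printing Implicit Defensive.
Import Order.TTheory GRing.Theory Num.Theory.
Local Open Scope ring_scope.

(* The function field of the curve y^d = f(x) over K is
   F = K(x)[Y] / (Y^d - f(x)).  Its elements are represented by
   polynomials in Y with coefficients in K(x) = {fraction {poly K}}. *)
Section Curve.
Variable K : fieldType.
Local Notation FX := {fraction {poly K}}.

Definition curve_mod (f : {poly K}) (d : nat) : {poly FX} :=
  'X^d - (FracField.tofrac f)%:P.

Definition fun_x : {poly FX} := (FracField.tofrac ('X : {poly K}))%:P.
Definition fun_const (c : K) : {poly FX} := (FracField.tofrac (c%:P : {poly K}))%:P.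

(* valuations with values in Z u {oo}, oo encoded as None *)
Definition oi_add (a b : option int) : option int :=
  match a, b with Some x, Some y => Some (x + y) | _, _ => None end.
Definition oi_ge (a : option int) (z : int) : bool :=
  match a with None => true | Some x => (z <= x)%R end.

(* A place (= point of the smooth projective model) of the function field
   F/K: a normalized discrete valuation of F, trivial on K^*, given on
   representatives (value oo exactly on the representatives of 0). *)
Definition is_place (f : {poly K}) (d : nat) (v : {poly FX} -> option int) : Prop :=
  [/\ (forall p, v p = None <-> curve_mod f d %| p),
      (forall p q, v (p * q) = oi_add (v p) (v q)),
      (forall p q (z : int), oi_ge (v p) z -> oi_ge (v q) z -> oi_ge (v (p + q)) z),
      (forall c : K, c != 0 -> v (fun_const c) = Some 0)
    & (exists t, v t = Some 1)].

Definition same_place (v w : {poly FX} -> option int) : Prop := forall p, v p = w p.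

(* O: the unique place at infinity, where x has a pole *)
Definition is_place_at_infinity (v : {poly FX} -> option int) : Prop :=
  exists z : int, v fun_x = Some z /\ (z < 0)%R.

Definition indic (P : Prop) : int :=
  if excluded_middle_informative P then 1 else 0.

Definition multiple_principal (f : {poly K}) (d : nat) (Q : {poly FX} -> option int)
    (k : nat) : Prop :=
  exists h : {poly FX}, ~~ (curve_mod f d %| h) /\
    forall v, is_place f d v ->
      v h = Some (k%:Z * indic (same_place v Q) - k%:Z * indic (is_place_at_infinity v)).

(* cl((Q)-(O)) has order m in J(C)(K) = Pic^0(C) *)
Definition point_has_order (f : {poly K}) (d : nat) (Q : {poly FX} -> option int)
    (m : nat) : Prop :=
  [/\ is_place f d Q, (0 < m)%N, multiple_principal f d Q m
    & forall k : nat, (0 < k < m)%N -> ~ multiple_principal f d Q k].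

Definition no_repeated_roots (f : {poly K}) : Prop :=
  forall a : K, ~~ (('X - a%:P) ^+ 2 %| f).

Definition reachable (n d m : nat) : Prop :=
  (1 < m)%N /\
  exists f : {poly K}, [/\ f \is monic, size f = n.+1, no_repeated_roots f
    & exists Q, point_has_order f d Q m].

End Curve.

(* Main.v *)
(* A function with divisor k(Q) - k(O) is integral over K[x], hence of the form
   sum_i s_i(x) y^i, and the pole orders d deg s_i + n i at O of its terms are
   pairwise distinct.

   (a) If k = d k0 with n < k < n + d, only h = s + c y is possible.  If c = 0 then
   s is a multiple of (x - a)^k0, and x - a already has divisor d(Q) - d(O).
   Otherwise the norm s^d - (-c)^d f of h is a multiple of (x - a)^(d k0), and
   factoring s - e (x - a)^k0 out of s^d - e^d (x - a)^(d k0), with e the leading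
   coefficient of s, leaves a factor of degree (d - 1) k0 dividing f.

   (b) With l = m / d and e = n + l - m, take d f = (x^l + r)^d - x^m for a generic
   r = x^e + const; then x^l + r - d^(1/d) y has divisor m(Q) - m(O).  If
   k < m is such that k(Q - O) is principal then so is (m - k)(Q - O), so only
   k <= m/2 has to be excluded.  There k < n, and the function is a polynomial in x,
   which also vanishes at the conjugates of Q; the exception d = 2, l = n, k = n needs
   a different curve, y^2 proportional to A (A + 2 x^n) / (x - 1)^2 with A quadratic. *)

Require Import Defs.
From mathcomp Require Import all_boot all_order all_algebra fraction.
From mathcomp Require Import zify ring.
From Stdlib Require Import ClassicalEpsilon.
Import Order.TTheory GRing.Theory Num.Theory.
Local Open Scope ring_scope.
Set Implicit Arguments. Unset Strict Implicit. Unset Printing Implicit Defensive.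

(** * Valuations *)

(** The curve is given only through its places, and a place is an arbitrary discrete valuation on
    representatives in $K(x)[Y]$. A divisor equation thus quantifies over valuations that nothing
    describes in advance, so most of the work is to determine them: every place is the one at
    infinity or lies over a point $(a,b)$ with $b^d=f(a)$; each such point carries a place, and only
    one if $b\ne 0$. At infinity and at the roots of $f$, the order of $f$ in $K(x)$ is $-n$ and
    $1$, hence prime to $d$; the extension is totally ramified there and the valuation is read off
    from weights of monomials. At the remaining points $Y$ is a unit with an expansion in powers of
    $x-a$, which exists because $d\ne 0$ in $K$. Valuations are written on representatives, so the
    value oo is taken on all multiples of $Y^d-f$ and not only at 0; this is why [pval] does not
    make oo characterise 0. In (b) genericity is quantitative: a double root of the candidate $f$
    satisfies an equation between logarithmic derivatives, which confines the free constant to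
    finitely many values. The condition on the characteristic makes that equation nontrivial. *)

Definition pval (R : comNzRingType) (v : R -> option int) : Prop :=
  [/\ v 0 = None, v 1 = Some 0, (forall p q, v (p * q) = oi_add (v p) (v q))
    & forall p q z, oi_ge (v p) z -> oi_ge (v q) z -> oi_ge (v (p + q)) z].

Section PseudoValuation.
Variables (R : comNzRingType) (v : R -> option int).
Hypothesis hv : pval v.

Lemma pval0 : v 0 = None. Proof. by case: hv. Qed.
Lemma pval1 : v 1 = Some 0. Proof. by case: hv. Qed.
Lemma pvalM p q : v (p * q) = oi_add (v p) (v q). Proof. by case: hv. Qed.

Lemma pval_ge0 z : oi_ge (v 0) z. Proof. by rewrite pval0. Qed.

Lemma pval_geD z p q : oi_ge (v p) z -> oi_ge (v q) z -> oi_ge (v (p + q)) z.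
Proof. by case: hv => _ _ _; apply. Qed.

Lemma oi_ge_le (a : option int) (z z' : int) : z' <= z -> oi_ge a z -> oi_ge a z'.
Proof. by case: a => //= x; lia. Qed.

Lemma pval_geM a b p q :
  oi_ge (v p) a -> oi_ge (v q) b -> oi_ge (v (p * q)) (a + b).
Proof. by rewrite pvalM; case: (v p) (v q) => [x|] [y|] //=; lia. Qed.

Lemma pvalMs a b p q : v p = Some a -> v q = Some b -> v (p * q) = Some (a + b).
Proof. by rewrite pvalM => -> ->. Qed.

Lemma pvalN1 : v (- 1) = Some 0.
Proof.
have := pvalM (- 1) (- 1); rewrite mulrNN mulr1 pval1.
by case: (v (- 1)) => [x|] //= [] h; congr Some; lia.
Qed.

Lemma pvalN p : v (- p) = v p.
Proof. by rewrite -mulN1r pvalM pvalN1; case: (v p) => //= x; rewrite add0r. Qed.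

Lemma pval_geB z p q : oi_ge (v p) z -> oi_ge (v q) z -> oi_ge (v (p - q)) z.
Proof. by move=> hp hq; apply: pval_geD => //; rewrite pvalN. Qed.

Lemma pval_ge_sum (I : Type) (r : seq I) (P : pred I) (F : I -> R) z :
  (forall i, P i -> oi_ge (v (F i)) z) -> oi_ge (v (\sum_(i <- r | P i) F i)) z.
Proof.
move=> h; elim/big_rec: _ => [|i x Pi hx]; first exact: pval_ge0.
by apply: pval_geD => //; apply: h.
Qed.

Lemma pvalX a p k : v p = Some a -> v (p ^+ k) = Some (a * k%:Z).
Proof.
move=> h; elim: k => [|k IH]; first by rewrite expr0 mulr0 pval1.
by rewrite exprS (pvalMs h IH); congr Some; lia.
Qed.

Lemma pval_geX p k : oi_ge (v p) 0 -> oi_ge (v (p ^+ k)) 0.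
Proof.
move=> h; elim: k => [|k IH]; first by rewrite expr0 pval1.
by rewrite exprS -[0]addr0; apply: pval_geM.
Qed.

Lemma pvalD_dom a p q : v p = Some a -> oi_ge (v q) (a + 1) -> v (p + q) = Some a.
Proof.
move=> hp hq.
have h1 : oi_ge (v (p + q)) a.
  by apply: pval_geD; [rewrite hp /= | apply: oi_ge_le hq; lia].
have h2 : ~ oi_ge (v (p + q)) (a + 1).
  move=> h; have := pval_geB h hq; rewrite addrK hp /=; lia.
by move: h1 h2; case: (v (p + q)) => [x|] //= h1 h2; congr Some; lia.
Qed.

End PseudoValuation.

Lemma pval_comp (R S : comNzRingType) (g : {rmorphism R -> S}) v :
  pval v -> pval (v \o g).
Proof.
move=> hv; split=> /=; rewrite ?rmorph0 ?rmorph1 ?(pval0 hv) ?(pval1 hv) //.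
- by move=> p q; rewrite rmorphM (pvalM hv).
- by move=> p q z hp hq; rewrite rmorphD; apply: (pval_geD hv).
Qed.

(* K(x) is kept abstract: unifying ring structures on polynomials over the concrete
   quotient type {fraction {poly K}} is prohibitively slow. *)
Record fraction_model (R : idomainType) := FractionModel {
  fm_field :> fieldType;
  fm_inj : {rmorphism R -> fm_field};
  fm_injective : injective fm_inj;
  fm_quotient : forall q, exists u : R * R, q = fm_inj u.1 / fm_inj u.2 /\ u.2 != 0 }.

(** * Extension of an order function from a domain to its field of fractions *)

Section FractionValuation.
Variables (R : idomainType) (M : fraction_model R) (mu : R -> int).
Hypothesis muM : forall u u' : R, u != 0 -> u' != 0 -> mu (u * u') = mu u + mu u'.
Hypothesis muD : forall (u u' : R) (z : int), u != 0 -> u' != 0 -> u + u' != 0 ->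
  z <= mu u -> z <= mu u' -> z <= mu (u + u').
Local Notation FR := (fm_field M).
Local Notation tofrac := (fm_inj M).

Lemma fm_eq u u' : (tofrac u == tofrac u') = (u == u').
Proof. exact: (inj_eq (@fm_injective _ M)). Qed.

Lemma fm_eq0 u : (tofrac u == 0) = (u == 0).
Proof. by rewrite -(rmorph0 tofrac) fm_eq. Qed.

Definition numden (q : FR) : R * R :=
  proj1_sig (constructive_indefinite_description _ (fm_quotient q)).

Lemma frac_numdenE (q : FR) :
  q = tofrac (numden q).1 / tofrac (numden q).2 /\ (numden q).2 != 0.
Proof. by rewrite /numden; case: constructive_indefinite_description. Qed.

Lemma fractionE (q : FR) : exists u u', u' != 0 /\ q = tofrac u / tofrac u'.
Proof.
have [h1 h2] := frac_numdenE q; by exists (numden q).1, (numden q).2.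
Qed.

Definition fval (q : FR) : option int :=
  if q == 0 then None else Some (mu (numden q).1 - mu (numden q).2).

Lemma fval_mu1 : mu 1 = 0.
Proof.
have := muM (oner_neq0 _) (oner_neq0 _); rewrite mulr1 => h.
by apply: (addrI (mu 1)); rewrite addr0 -h.
Qed.

(** Cross-multiplying the given fraction with the one chosen by [numden] shows that the value does
    not depend on that choice. *)
Lemma fvalE (u u' : R) : u != 0 -> u' != 0 ->
  fval (tofrac u / tofrac u') = Some (mu u - mu u').
Proof.
move=> hu hu'; rewrite /fval ifF; last first.
  by apply/negbTE; rewrite mulf_neq0 ?invr_eq0 ?fm_eq0.
set q := _ / _; have [Eq hd] := frac_numdenE q.
have hq : q != 0 by rewrite mulf_neq0 ?invr_eq0 ?fm_eq0.
have hn : (numden q).1 != 0.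
  by apply: contraNneq hq => h; rewrite Eq h rmorph0 mul0r.
have : u * (numden q).2 = (numden q).1 * u'.
  apply/eqP; rewrite -fm_eq !rmorphM /=; apply/eqP.
  have h1 : tofrac u = q * tofrac u' by rewrite divfK ?fm_eq0.
  by rewrite h1 {1}Eq mulrAC divfK ?fm_eq0.
move/(congr1 mu); rewrite !muM // => h; congr Some; lia.
Qed.

Lemma fval_tofrac u : u != 0 -> fval (tofrac u) = Some (mu u).
Proof.
move=> hu; have := fvalE hu (oner_neq0 _); rewrite rmorph1 divr1 => ->.
by rewrite fval_mu1 subr0.
Qed.

Lemma fval_eq_None q : fval q = None <-> q = 0.
Proof. by rewrite /fval; case: eqP. Qed.

Lemma fval_ind (P : FR -> Prop) :
  P 0 -> (forall u u' : R, u != 0 -> u' != 0 -> P (tofrac u / tofrac u')) -> forall q, P q.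
Proof.
move=> P0 PN q; have [u [u' [hu' ->]]] := fractionE q.
by have [->|hu] := eqVneq u 0; [rewrite rmorph0 mul0r | apply: PN].
Qed.

Lemma fval_pval : pval fval.
Proof.
have f0 : fval 0 = None by rewrite /fval eqxx.
split=> //.
- rewrite -(rmorph1 tofrac) fval_tofrac ?oner_neq0 //.
  by rewrite fval_mu1.
- elim/fval_ind => [q|u u' hu hu']; first by rewrite mul0r f0.
  elim/fval_ind => [|w w' hw hw']; first by rewrite mulr0 f0; case: (fval _).
  rewrite mulf_div -!rmorphM !fvalE ?mulf_neq0 //= !muM //; congr Some; lia.
- elim/fval_ind => [q z _|u u' hu hu']; first by rewrite add0r.
  elim/fval_ind => [|w w' hw hw'] z; first by rewrite addr0.
  rewrite addf_div ?fm_eq0 // -!rmorphM -rmorphD.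
  have [->|hs] := eqVneq (u * w' + w * u') 0; first by rewrite rmorph0 mul0r f0.
  rewrite !fvalE ?mulf_neq0 //= => h1 h2; rewrite muM //.
  rewrite lerBrDr; by apply: muD; rewrite ?mulf_neq0 // muM //; lia.
Qed.

End FractionValuation.

(** * Orders of a rational function at a point and at infinity *)

Section OrderOfRationalFunction.
Variable K : fieldType.
Variable M : fraction_model {poly K}.
Local Notation FX := (fm_field M).
Local Notation tofrac := (fm_inj M).
Implicit Types (u : {poly K}) (a : K).

Definition mup_int a u : int := (mup a u)%:Z.
(** Order at infinity. At [u = 0] it takes the meaningless value 0, which is why the laws asked of
    an order function concern nonzero polynomials only. *)
Definition degN u : int := - ((size u).-1)%:Z.

Lemma mup_intM a u u' : u != 0 -> u' != 0 -> mup_int a (u * u') = mup_int a u + mup_int a u'.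
Proof. by move=> hu hu'; rewrite /mup_int mupM // PoszD. Qed.

Lemma mup_intD a u u' z : u != 0 -> u' != 0 -> u + u' != 0 ->
  z <= mup_int a u -> z <= mup_int a u' -> z <= mup_int a (u + u').
Proof.
case: z => [k|k] hu hu' hs; rewrite /mup_int ?lez_nat; last by lia.
by rewrite !mup_geq // => h h'; rewrite dvdp_add.
Qed.

Lemma degNM u u' : u != 0 -> u' != 0 -> degN (u * u') = degN u + degN u'.
Proof.
move=> hu hu'; rewrite /degN size_mul //.
move: hu hu'; rewrite -!size_poly_gt0; move: (size u) (size u') => [|i] [|j] // _ _.
by rewrite addSn addnS /= PoszD; lia.
Qed.

Lemma degND u u' (z : int) : u != 0 -> u' != 0 -> u + u' != 0 ->
  z <= degN u -> z <= degN u' -> z <= degN (u + u').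
Proof.
rewrite -!size_poly_gt0 /degN; have := size_polyD u u'; lia.
Qed.

Definition ord_at a : FX -> option int := fval (mup_int a).
Definition ord_oo : FX -> option int := fval degN.

Lemma ord_at_pval a : pval (ord_at a).
Proof. exact: fval_pval (@mup_intM a) (@mup_intD a). Qed.

Lemma ord_oo_pval : pval ord_oo.
Proof. exact: fval_pval degNM degND. Qed.

Lemma ord_at_tofrac a u : u != 0 -> ord_at a (tofrac u) = Some (mup a u)%:Z.
Proof. exact: fval_tofrac (@mup_intM a) u. Qed.

Lemma ord_oo_tofrac u : u != 0 -> ord_oo (tofrac u) = Some (- ((size u).-1)%:Z).
Proof. exact: fval_tofrac degNM u. Qed.

Lemma ord_at_ge0 a u : oi_ge (ord_at a (tofrac u)) 0.
Proof.
have [->|hu] := eqVneq u 0; first by rewrite rmorph0 /ord_at /fval eqxx.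
by rewrite ord_at_tofrac.
Qed.

Lemma ord_at_ge a u k : ('X - a%:P) ^+ k %| u -> oi_ge (ord_at a (tofrac u)) k%:Z.
Proof.
have [->|hu] := eqVneq u 0; first by rewrite rmorph0 /ord_at /fval eqxx.
by rewrite ord_at_tofrac //= lez_nat mup_geq.
Qed.

Lemma ord_at_XsubC a : ord_at a (tofrac ('X - a%:P)) = Some 1.
Proof.
by rewrite ord_at_tofrac ?polyXsubC_eq0 // (@mup_XsubCX _ 1) eqxx.
Qed.

Lemma ord_oo_X : ord_oo (tofrac 'X) = Some (-1).
Proof. by rewrite ord_oo_tofrac ?polyX_eq0 // size_polyX. Qed.

Lemma ord_at_None a q : ord_at a q = None <-> q = 0.
Proof. exact: fval_eq_None. Qed.

Lemma ord_oo_None q : ord_oo q = None <-> q = 0.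
Proof. exact: fval_eq_None. Qed.

Lemma pval_inv (F : fieldType) (w : F -> option int) q x : pval w -> 
  w q = Some x -> w q^-1 = Some (- x).
Proof.
move=> hw hq; have q0 : q != 0 by apply: contra_eq_neq hq => ->; rewrite (pval0 hw).
have := pvalM hw q q^-1; rewrite mulfV // (pval1 hw) hq.
case: (w q^-1) => //= y [h]; congr Some; lia.
Qed.

Lemma pval_surj (F : fieldType) (w : F -> option int) q : pval w -> 
  (w q = Some 1 \/ w q = Some (-1)) -> forall z, exists q', w q' = Some z.
Proof.
move=> hw hq z.
have [r hr] : exists r, w r = Some 1.
  case: hq => h; first by exists q.
  by exists q^-1; rewrite (pval_inv hw h).
case: z => k.
  by exists (r ^+ k); rewrite (pvalX hw _ hr) mul1r.
exists (r ^+ k.+1)^-1; rewrite (pval_inv hw (pvalX hw _ hr)); congr Some; lia.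
Qed.

(** Cancelling the common power of $x-a$ leaves $r/p'$ with $p'(a)\ne 0$, and the residue is
    $r(a)/p'(a)$. *)
Lemma ord_at_regular_residue a q : oi_ge (ord_at a q) 0 ->
  exists c : K, oi_ge (ord_at a (q - tofrac c%:P)) 1.
Proof.
have hw := ord_at_pval a.
elim/fval_ind: q => [_|u u' hu hu'].
  by exists 0; rewrite rmorph0 subr0 (pval0 hw).
have mE p : p != 0 -> exists2 p1, p = p1 * ('X - a%:P) ^+ mup a p & p1.[a] != 0.
  move=> p0; have := mup_geq a (mup a p) p0; rewrite leqnn => /esym /dvdpP[p1 E].
  exists p1 => //; apply/negP => /eqP /eqP r.
  have : ('X - a%:P) ^+ (mup a p).+1 %| p.
    rewrite {2}E exprS dvdp_mul2r ?dvdp_XsubCl //.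
    by rewrite expf_neq0 // polyXsubC_eq0.
  by rewrite -mup_geq // ltnn.
have [p Ep pa] := mE _ hu; have [p' Ep' pa'] := mE _ hu'.
rewrite /ord_at (fvalE M (@mup_intM a)) // /mup_int /= => hm.
have X0 : ('X - a%:P : {poly K}) != 0 by rewrite polyXsubC_eq0.
have hle : (mup a u' <= mup a u)%N by lia.
set r := p * ('X - a%:P) ^+ (mup a u - mup a u').
have p'0 : p' != 0 by apply: contraNneq pa' => ->; rewrite horner0.
have -> : tofrac u / tofrac u' = tofrac r / tofrac p'.
  apply/eqP; rewrite eqr_div ?fm_eq0 // -!rmorphM fm_eq /= /r.
  by rewrite {1}Ep {2}Ep' -{1}(subnK hle) exprD; apply/eqP; rewrite !mulrA [RHS]mulrAC.
exists (r.[a] / p'.[a]).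
have -> : tofrac r / tofrac p' - tofrac (r.[a] / p'.[a])%:P =
          tofrac (r - (r.[a] / p'.[a])%:P * p') / tofrac p'.
  by rewrite rmorphB (rmorphM tofrac (r.[a] / p'.[a])%:P) mulrBl mulfK ?fm_eq0.
have h0 : ord_at a (tofrac p') = Some 0.
  by rewrite ord_at_tofrac // mupNroot.
rewrite -/(ord_at a _) -[1]addr0; apply: (pval_geM hw).
  apply: (@ord_at_ge a _ 1); rewrite dvdp_XsubCl rootE !hornerE divfK ?subrr //.
by rewrite (pval_inv hw h0).
Qed.

(** Induction on the size of the denominator: a root of it is also a root of the numerator, since
    there is no pole, and the common linear factor cancels. *)
Lemma ord_at_regular_poly (q : FX)
    (hK : forall p : {poly K}, (size p != 1)%N -> exists x, root p x) :
  (forall a, oi_ge (ord_at a q) 0) -> exists u, q = tofrac u.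
Proof.
have [u [u' [hu' ->]]] := fractionE q.
elim: {u'}(size u') {-2}u' (leqnn (size u')) u hu' => [|k IH] u' hk u hu' h.
  by move: hk hu'; rewrite leqn0 size_poly_eq0 => ->.
have [/eqP/size_poly1P[c c0 E]|] := eqVneq (size u') 1%N.
  exists (c^-1 *: u); rewrite E -mul_polyC rmorphM mulrC /=; congr (_ * _).
  have hc : tofrac c%:P != 0 by rewrite fm_eq0 polyC_eq0.
  by apply: (mulIf hc); rewrite mulVf // -!rmorphM /= mulVf // !rmorph1.
move=> /hK[a ra]; have [u1' E1'] := factor_theorem _ _ ra.
have u1'0 : u1' != 0 by apply: contraNneq hu' => z; rewrite E1' z mul0r.
have X0 : ('X - a%:P : {poly K}) != 0 by rewrite polyXsubC_eq0.
have [z|hu] := eqVneq u 0.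
  by exists 0; rewrite z rmorph0 mul0r.
have ru : root u a.
  rewrite -dvdp_XsubCl XsubC_dvd //.
  have := h a; rewrite /ord_at (fvalE M (@mup_intM a)) // /mup_int /=.
  have : (0 < mup a u')%N by rewrite -XsubC_dvd // dvdp_XsubCl.
  lia.
have [u1 E1] := factor_theorem _ _ ru.
have E : tofrac u / tofrac u' = tofrac u1 / tofrac u1'.
  by apply/eqP; rewrite eqr_div ?fm_eq0 // -!rmorphM fm_eq /= {1}E1 E1';
    apply/eqP; rewrite mulrAC mulrA.
rewrite E; apply: IH => //; last by move=> b; rewrite -E.
by move: hk; rewrite E1' size_Mmonic ?monicXsubC // size_XsubC; lia.
Qed.

End OrderOfRationalFunction.

(** * Places of a radical extension *)

Section ValuationOfRelation.
Variables (F : fieldType) (C : {poly F}) (val : {poly F} -> int -> Prop).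
Hypothesis val_fun : forall P z z', val P z -> val P z' -> z = z'.
Hypothesis val_dvd : forall P, (exists z, val P z) <-> ~~ (C %| P).
Hypothesis valM : forall P Q z z', val P z -> val Q z' -> val (P * Q) (z + z').
Hypothesis valD : forall P Q z z' z'' t, val P z -> val Q z' -> val (P + Q) z'' ->
  t <= z -> t <= z' -> t <= z''.
Hypothesis val_mod : forall P Q z, val P z -> C %| Q -> val (P + Q) z.

(** The places below are defined by a property of some good representative or approximation.
    Classical choice turns such a relation into a function, with oo where the relation gives no
    value. *)
Definition val_of (P : {poly F}) : option int :=
  match excluded_middle_informative (exists z, val P z) with
  | left h => Some (proj1_sig (constructive_indefinite_description _ h))
  | right _ => None
  end.

Lemma val_ofP P z : val_of P = Some z <-> val P z.
Proof.
rewrite /val_of; case: excluded_middle_informative => [h|h]; last first.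
  by split=> // hz; case: h; exists z.
case: constructive_indefinite_description => z' hz' /=; split=> [[<-]//|hz].
by congr Some; apply: val_fun hz' hz.
Qed.

Lemma val_of_None P : val_of P = None <-> C %| P.
Proof.
have [h1 h2] := val_dvd P; split=> h.
  apply: contraT => /h2[z /val_ofP]; by rewrite h.
case E: (val_of P) => [z|] //; move/val_ofP: E => E.
by have := h1 (ex_intro _ z E); rewrite h.
Qed.

Lemma val_ofM P Q : val_of (P * Q) = oi_add (val_of P) (val_of Q).
Proof.
case EP: (val_of P) => [z|] /=; last first.
  by apply/val_of_None/dvdp_mulr/val_of_None.
case EQ: (val_of Q) => [z'|] /=; last first.
  by apply/val_of_None/dvdp_mull/val_of_None.
by apply/val_ofP/valM; apply/val_ofP.
Qed.

Lemma val_ofD P Q z :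
  oi_ge (val_of P) z -> oi_ge (val_of Q) z -> oi_ge (val_of (P + Q)) z.
Proof.
case EP: (val_of P) => [x|] /=; case EQ: (val_of Q) => [y|] //= hx hy.
- case ES: (val_of (P + Q)) => [s|] //=; move/val_ofP: ES; move/val_ofP: EP; move/val_ofP: EQ.
  by move=> EQ EP ES; apply: valD EP EQ ES hx hy.
- move/val_of_None: EQ => EQ; move/val_ofP: EP => EP.
  by have /val_ofP-> := val_mod EP EQ.
- move/val_of_None: EP => EP; move/val_ofP: EQ => EQ.
  by rewrite addrC; have /val_ofP-> := val_mod EQ EP.
- move/val_of_None: EP => EP; move/val_of_None: EQ => EQ.
  by have /val_of_None-> := dvdp_add EP EQ.
Qed.

End ValuationOfRelation.

(** * The valuation of a totally ramified radical extension *)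

Section TotallyRamified.
Variables (F : fieldType) (w : F -> option int) (phi : F) (d : nat) (e : int).
Hypothesis hw : pval w.
Hypothesis w_None : forall q, w q = None <-> q = 0.
Hypothesis d_gt0 : (0 < d)%N.
Hypothesis w_phi : w phi = Some e.
Hypothesis cop : coprime d `|e|.
Let C : {poly F} := 'X^d - phi%:P.

Lemma size_radical : size C = d.+1.
Proof. by rewrite /C size_XnsubC. Qed.

Lemma radical_neq0 : C != 0.
Proof. by rewrite -size_poly_gt0 size_radical. Qed.

(** The weight of the monomial $cY^j$ when [w] is multiplied by the ramification index [d] and $Y$
    has value [e]. Then $Y^d$ and [phi] have the same weight, so reduction modulo [C] preserves
    weights of monomials. *)
Definition wval (j : nat) (c : F) : option int :=
  omap (fun x => d%:Z * x + e * j%:Z) (w c).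

Definition gauss (R : {poly F}) (z : int) := forall j, oi_ge (wval j R`_j) z.

Lemma wval_ge0 j z : oi_ge (wval j 0) z.
Proof. by rewrite /wval (pval0 hw). Qed.

Lemma wvalD j a b z : oi_ge (wval j a) z -> oi_ge (wval j b) z -> oi_ge (wval j (a + b)) z.
Proof.
rewrite /wval; case Ea: (w a) => [x|] /=; last first.
  by move/w_None: Ea => -> _; rewrite add0r.
case Eb: (w b) => [y|] /=; last first.
  by move/w_None: Eb => -> h _; rewrite addr0 Ea.
move=> hx hy.
have hab : oi_ge (w (a + b)) (Num.min x y).
  by apply: (pval_geD hw); rewrite ?Ea ?Eb /=; lia.
case Es: (w (a + b)) hab => [s|] //= hab.
have [hs|hs] : x <= s \/ y <= s by lia.
- by have := ler_wpM2l (ler0n int d) hs; rewrite natz; lia.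
- by have := ler_wpM2l (ler0n int d) hs; rewrite natz; lia.
Qed.

Lemma wvalM i j a b z z' :
  oi_ge (wval i a) z -> oi_ge (wval j b) z' -> oi_ge (wval (i + j) (a * b)) (z + z').
Proof.
rewrite /wval (pvalM hw); case: (w a) (w b) => [x|] [y|] //= h h'.
by rewrite mulrDr PoszD mulrDr; lia.
Qed.

Lemma wvalN j a : wval j (- a) = wval j a.
Proof. by rewrite /wval (pvalN hw). Qed.

Lemma gaussD P Q z : gauss P z -> gauss Q z -> gauss (P + Q) z.
Proof. by move=> hP hQ j; rewrite coefD; apply: wvalD. Qed.

Lemma gaussB P Q z : gauss P z -> gauss Q z -> gauss (P - Q) z.
Proof. by move=> hP hQ j; rewrite coefB; apply: wvalD => //; rewrite wvalN. Qed.

Lemma gauss_le P z z' : z' <= z -> gauss P z -> gauss P z'.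
Proof. by move=> hz hP j; apply: oi_ge_le (hP j). Qed.

Lemma gaussM P Q z z' : gauss P z -> gauss Q z' -> gauss (P * Q) (z + z').
Proof.
move=> hP hQ j; rewrite coefM; elim/big_rec: _ => [|i x _ hx]; first exact: wval_ge0.
apply: wvalD => //.
have -> : wval j (P`_i * Q`_(j - i)) = wval (i + (j - i)) (P`_i * Q`_(j - i)).
  by rewrite subnKC // -ltnS.
exact: wvalM.
Qed.

Lemma gauss_mono c i z : oi_ge (wval i c) z -> gauss (c *: 'X^i) z.
Proof.
move=> h j; rewrite coefZ coefXn; case: eqP => [->|_]; first by rewrite mulr1.
by rewrite mulr0; apply: wval_ge0.
Qed.

Lemma modp_mono c i : (c *: 'X^i) %% C = (c * phi ^+ (i %/ d)) *: 'X^(i %% d).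
Proof.
have hX m : ('X^d ^+ m - (phi ^+ m)%:P) %% C = 0.
  by apply/modp_eq0; rewrite rmorphXn /= subrXX dvdp_mulr.
have -> : c *: 'X^i = (c *: 'X^(i %% d)) * ('X^d ^+ (i %/ d) - (phi ^+ (i %/ d))%:P)
     + (c * phi ^+ (i %/ d)) *: 'X^(i %% d).
  rewrite mulrBr -exprM -scalerAl -exprD addnC mulnC -divn_eq.
  by rewrite [X in _ - X]mulrC mul_polyC scalerA [phi ^+ _ * c]mulrC subrK.
rewrite modpD -modp_mul hX mulr0 mod0p add0r modp_small //.
apply: leq_ltn_trans (size_scale_leq _ _) _.
by rewrite size_polyXn size_radical ltnS ltn_pmod.
Qed.

Lemma wval_modn i c : wval (i %% d) (c * phi ^+ (i %/ d)) = wval i c.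
Proof.
rewrite /wval (pvalM hw) (pvalX hw _ w_phi); case: (w c) => //= x.
by rewrite {3}(divn_eq i d) PoszD PoszM; congr Some; ring.
Qed.

Lemma gauss_mod P z : gauss P z -> gauss (P %% C) z.
Proof.
move=> hP; rewrite -[P]coefK poly_def.
elim/big_rec: _ => [|i Q _ hQ]; first by rewrite mod0p => j; rewrite coef0; apply: wval_ge0.
rewrite modpD; apply: gaussD => //; rewrite modp_mono; apply: gauss_mono.
by rewrite wval_modn.
Qed.

(** If [C] divided the sum, the reduced dominant monomial would be the opposite of a coefficient of
    the reduction of [R]. The former keeps its weight, while the latter has strictly larger
    weight. *)
Lemma dominant_ndvd c i x R : w c = Some x -> 
  gauss R (d%:Z * x + e * i%:Z + 1) -> ~~ (C %| c *: 'X^i + R).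
Proof.
move=> hc hR; apply/negP => /modp_eq0; rewrite modpD modp_mono => /eqP.
rewrite addrC addr_eq0 => /eqP /(congr1 (fun p : {poly F} => p`_(i %% d))).
rewrite coefN coefZ coefXn eqxx mulr1 => E.
by have := gauss_mod hR (i %% d)%N; rewrite E wvalN wval_modn /wval hc /=; lia.
Qed.

(* P is congruent to a dominant monomial plus terms of larger weight; since e is prime
   to d, the weights of monomials of degree < d are pairwise distinct, so every class
   modulo C has such a form. *)
Definition ram_val (P : {poly F}) (z : int) := exists c i R x,
  [/\ C %| P - (c *: 'X^i + R), w c = Some x, z = d%:Z * x + e * i%:Z & gauss R (z + 1)].

Lemma ram_val_gauss P z : ram_val P z -> exists2 R, C %| P - R & gauss R z.
Proof.
case=> c [i [R [x [h hc hz hR]]]]; exists (c *: 'X^i + R) => //.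
apply: gaussD; last by apply: gauss_le hR; lia.
by apply: gauss_mono; rewrite /wval hc /= hz.
Qed.

Lemma ram_val_ge P z S t : ram_val P z -> C %| P - S -> gauss S t -> t <= z.
Proof.
case=> c [i [R [x [h hc hz hR]]]] hS gS; rewrite leNgt; apply/negP => lt.
have : C %| c *: 'X^i + (R - S).
  have -> : c *: 'X^i + (R - S) = (P - S) - (P - (c *: 'X^i + R)) by ring.
  exact: dvdp_sub.
apply/negP; apply: dominant_ndvd hc _; rewrite -hz; apply: gaussB => //.
by apply: gauss_le gS; lia.
Qed.

Lemma ram_val_fun P z z' : ram_val P z -> ram_val P z' -> z = z'.
Proof.
move=> h h'; have [R hR gR] := ram_val_gauss h; have [R' hR' gR'] := ram_val_gauss h'.
by have := ram_val_ge h hR' gR'; have := ram_val_ge h' hR gR; lia.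
Qed.

Lemma ram_valD P Q z z' z'' t : ram_val P z -> ram_val Q z' -> ram_val (P + Q) z'' ->
  t <= z -> t <= z' -> t <= z''.
Proof.
move=> h h' h'' tz tz'.
have [R hR gR] := ram_val_gauss h; have [R' hR' gR'] := ram_val_gauss h'.
apply: (@ram_val_ge _ _ (R + R') _ h''); last first.
  by apply: gaussD; [apply: gauss_le gR | apply: gauss_le gR'].
have -> : P + Q - (R + R') = (P - R) + (Q - R') by ring.
exact: dvdp_add.
Qed.

Lemma ram_val_mod P Q z : ram_val P z -> C %| Q -> ram_val (P + Q) z.
Proof.
case=> c [i [R [x [h hc hz hR]]]] hQ; exists c, i, R, x; split=> //.
by rewrite addrAC; apply: dvdp_add.
Qed.

Lemma ram_valM P Q z z' : ram_val P z -> ram_val Q z' -> ram_val (P * Q) (z + z').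
Proof.
case=> c [i [R [x [h hc hz hR]]]] [c' [i' [R' [x' [h' hc' hz' hR']]]]].
exists (c * c'), (i + i')%N, (c *: 'X^i * R' + R * (c' *: 'X^i' + R')), (x + x').
have g1 : gauss (c *: 'X^i) z by apply: gauss_mono; rewrite /wval hc /= hz.
have g1' : gauss (c' *: 'X^i') z' by apply: gauss_mono; rewrite /wval hc' /= hz'.
split.
- have -> : P * Q - ((c * c') *: 'X^(i + i') + (c *: 'X^i * R' + R * (c' *: 'X^i' + R')))
     = (P - (c *: 'X^i + R)) * Q + (Q - (c' *: 'X^i' + R')) * (c *: 'X^i + R).
    by rewrite -!mul_polyC polyCM exprD; ring.
  by apply: dvdp_add; apply: dvdp_mulr.
- exact: (pvalMs hw).
- by rewrite hz hz' PoszD; ring.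
- apply: gaussD; first by rewrite -addrA; apply: gaussM.
  rewrite addrAC; apply: gaussM => //; apply: gaussD => //.
  by apply: gauss_le hR'; rewrite lerDl.
Qed.

Lemma wval_inj i j a b z : (i < d)%N -> (j < d)%N -> wval i a = Some z -> wval j b = Some z -> i = j.
Proof.
rewrite /wval; case: (w a) (w b) => [x|] [y|] //= hi hj [h] [h'].
have : (d%:Z %| e * (i%:Z - j%:Z))%Z.
  by apply/dvdzP; exists (y - x); rewrite -[LHS]subr0 -(subrr z) -{1}h -h'; ring.
rewrite Gauss_dvdzr; last by rewrite coprimezE.
move/dvdzP=> [q hq]; have [q1|[q1|q0]] : 1 <= q \/ q <= -1 \/ q = 0 by lia.
- have := ler_wpM2r (ler0n int d) q1; rewrite natz mul1r -hq; lia.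
- have := ler_wpM2r (ler0n int d) q1; rewrite natz mulN1r -hq; lia.
- by move: hq; rewrite q0 mul0r; lia.
Qed.

Lemma ram_val_dvd P : (exists z, ram_val P z) <-> ~~ (C %| P).
Proof.
split=> [[z [c [i [R [x [h hc hz hR]]]]]]|hP].
  apply/negP => hP; have := dvdp_sub hP h; rewrite opprB addrC subrK.
  by apply/negP; apply: dominant_ndvd hc _; rewrite -hz.
have hP' : P %% C != 0 by apply: contra hP => /eqP/modp_eq0P.
have sP : (size (P %% C)%R <= d)%N by rewrite -ltnS -size_radical ltn_modp radical_neq0.
set S := P %% C in hP' sP *.
have [i0 hi0] : exists i : 'I_d, S`_i != 0.
  have ls : ((size S).-1 < d)%N by move: hP' sP; rewrite -size_poly_gt0; case: (size S).
  by exists (Ordinal ls) => /=; rewrite -lead_coefE lead_coef_eq0.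
pose g (i : 'I_d) := odflt 0 (wval i S`_i).
have hg (i : 'I_d) : S`_i != 0 -> wval i S`_i = Some (g i).
  move=> hi; rewrite /g /wval; case E: (w _) => [x|] //=.
  by move/w_None: E => E; rewrite E eqxx in hi.
case: (@Order.TotalTheory.arg_minP _ int _ i0 (fun i : 'I_d => S`_i != 0) g hi0) => i hi hmin.
exists (g i); move: (hg _ hi); rewrite {1}/wval; case E: (w S`_i) => [x|] //= [hx].
exists S`_i, i, (S - S`_i *: 'X^i), x; split=> //.
  by rewrite addrCA subrr addr0 /S; apply/modp_eq0P; rewrite modpD modpN modp_id subrr.
move=> j; rewrite coefB coefZ coefXn; have [->|ne] := eqVneq j i.
  by rewrite mulr1 subrr; apply: wval_ge0.
rewrite mulr0 subr0; have [->|hj] := eqVneq S`_j 0; first exact: wval_ge0.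
have lj : (j < d)%N.
  by rewrite ltnNge; apply: contra hj => h; rewrite nth_default // (leq_trans sP).
have Ej := hg (Ordinal lj) hj; rewrite Ej /=.
have := hmin (Ordinal lj) hj; rewrite le_eqVlt => /orP[/eqP Eq|]; last by lia.
have Ej' : wval j S`_j = Some (g i) by rewrite Eq.
by have ij := wval_inj (ltn_ord i) lj (hg _ hi) Ej'; rewrite ij eqxx in ne.
Qed.

(** Irreducibility of $Y^d-\phi$ is a by-product of the valuation: an element has a finite value
    exactly when [C] does not divide it, and finite values add up under products. *)
Lemma radical_prime P Q : C %| P * Q -> (C %| P) || (C %| Q).
Proof.
move=> h; apply: contraT; rewrite negb_or => /andP[/ram_val_dvd[z hz] /ram_val_dvd[z' hz']].
by have /ram_val_dvd := ex_intro _ (z + z') (ram_valM hz hz'); rewrite h.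
Qed.

Definition ram_place := val_of ram_val.

Lemma ram_placeP P z : ram_place P = Some z <-> ram_val P z.
Proof. exact: (val_ofP ram_val_fun). Qed.

Lemma ram_place_axioms :
  [/\ (forall P, ram_place P = None <-> C %| P),
      (forall P Q, ram_place (P * Q) = oi_add (ram_place P) (ram_place Q))
    & forall P Q z, oi_ge (ram_place P) z -> oi_ge (ram_place Q) z ->
        oi_ge (ram_place (P + Q)) z].
Proof.
split.
- exact: (val_of_None ram_val_fun ram_val_dvd).
- exact: (val_ofM ram_val_fun ram_val_dvd ram_valM).
- exact: (val_ofD ram_val_fun ram_val_dvd ram_valD ram_val_mod).
Qed.

Lemma ram_val_mono c i x : w c = Some x -> ram_val (c *: 'X^i) (d%:Z * x + e * i%:Z).
Proof.
move=> hc; exists c, i, 0, x; split=> //; first by rewrite addr0 subrr dvdp0.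
by move=> j; rewrite coef0; apply: wval_ge0.
Qed.

Lemma ram_place_polyC c x : w c = Some x -> ram_place c%:P = Some (d%:Z * x).
Proof.
move=> hc; apply/ram_placeP.
have := ram_val_mono 0 hc; rewrite mulr0 addr0 expr0.
by rewrite -mul_polyC mulr1.
Qed.

Lemma ram_place_X : ram_place 'X = Some e.
Proof.
apply/ram_placeP; have := ram_val_mono 1 (pval1 hw).
by rewrite scale1r expr1 mulr0 mulr1 add0r.
Qed.

Lemma ram_place_unif : (forall z, exists q, w q = Some z) -> exists t, ram_place t = Some 1.
Proof.
move=> hs.
have [u [v huv]] : exists u v : int, u * e + v * d%:Z = 1.
  have /coprimezP[[u v] /= h] : coprimez e d%:Z by rewrite coprimezE coprime_sym.
  by exists u, v.
(* The Bezout coefficient of [e] may be negative, so its remainder modulo [d] serves as the exponent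
   of $Y$; the quotient is moved into the value of the coefficient [q]. *)
pose i := `|(u %% d%:Z)%Z|%N.
have hi : i%:Z = (u %% d%:Z)%Z by rewrite gez0_abs // modz_ge0 //; lia.
have [q hq] := hs (v + (u %/ d%:Z)%Z * e).
exists (q *: 'X^i); apply/ram_placeP.
have -> : 1 = d%:Z * (v + (u %/ d%:Z)%Z * e) + e * i%:Z; last exact: ram_val_mono.
by rewrite hi -huv {1}(divz_eq u d%:Z); ring.
Qed.

Lemma ram_place_coef P z j : oi_ge (ram_place P) z -> oi_ge (wval j (P %% C)`_j) z.
Proof.
case E: (ram_place P) => [x|] /=; last first.
  move=> _; case: ram_place_axioms => h _ _; move/h: E => /modp_eq0 ->.
  by rewrite coef0; apply: wval_ge0.
move/ram_placeP: E => /ram_val_gauss[R hR gR] hz.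
have -> : P %% C = R %% C.
  by apply/eqP; rewrite -subr_eq0 -modpN -modpD; apply/eqP/modp_eq0.
exact: (gauss_mod (gauss_le hz gR)).
Qed.

(** From $Y^d\equiv\phi$ one gets $d\,v(Y)=c\,e$, so $d\mid c$; with $c=dt$, $v(Y)=te$. Hence [v] is
    [t] times the weight on monomials, and by dominance [t] times [ram_val] throughout. An element
    of value 1 forces $t=1$. *)
Lemma ram_place_uniq (v : {poly F} -> option int) (c : int) :
  pval v -> (forall P, v P = None <-> C %| P) -> 0 < c ->
  (forall q x, w q = Some x -> v q%:P = Some (c * x)) -> (exists t, v t = Some 1) ->
  forall P, v P = ram_place P.
Proof.
move=> hv vN c0 hvw [T hT].
have hX : exists y, v 'X = Some y.
  case E: (v 'X) => [y|]; first by exists y.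
  have := pvalM hv 'X^(d.-1) 'X; rewrite -exprSr prednK // E.
  have -> : ('X^d : {poly F}) = phi%:P + C by rewrite /C addrC subrK.
  have hC : v C = None by apply/vN.
  have := pvalD_dom hv (hvw _ _ w_phi) (q := C); rewrite hC => ->//.
  by case: (v _).
case: hX => y hy.
have hdy : d%:Z * y = c * e.
  have h1 := pvalX hv d hy; have hC : v C = None by apply/vN.
  have := pvalD_dom hv (hvw _ _ w_phi) (q := C); rewrite hC => /(_ isT).
  by rewrite /C addrC subrK h1 => -[]; rewrite mulrC.
have [t ht] : exists t, c = d%:Z * t.
  have : (d%:Z %| c * e)%Z by apply/dvdzP; exists y; rewrite -hdy mulrC.
  rewrite Gauss_dvdzl; last by rewrite coprimezE.
  by case/dvdzP=> t ->; exists t; rewrite mulrC.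
have dz : d%:Z != 0 by lia.
have ht' : y = e * t by apply: (mulfI dz); rewrite hdy ht; ring.
have t0 : 0 < t by rewrite ht pmulr_rgt0 // in c0; lia.
have vterm q i x : w q = Some x -> v (q *: 'X^i) = Some (t * (d%:Z * x + e * i%:Z)).
  move=> hq; rewrite -mul_polyC (pvalMs hv (hvw _ _ hq) (pvalX hv i hy)).
  by congr Some; rewrite ht ht'; ring.
have vgauss R z : gauss R z -> oi_ge (v R) (t * z).
  move=> gR; rewrite -[R]coefK poly_def; apply: (pval_ge_sum hv) => i _.
  have := gR i; rewrite /wval; case E: (w R`_i) => [x|] /=.
    by move=> hz; rewrite (vterm _ _ _ E) /= ler_wpM2l // ltW.
  by move/w_None: E => ->; rewrite scale0r (pval0 hv).
have vval P z : ram_val P z -> v P = Some (t * z).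
  case=> q [i [R [x [h hq hz hR]]]].
  have h1 : v (q *: 'X^i + R) = Some (t * z).
    apply: (pvalD_dom hv); first by rewrite (vterm _ _ _ hq) hz.
    apply: oi_ge_le (vgauss _ _ hR); rewrite mulrDr mulr1; lia.
  have := pvalD_dom hv h1 (q := P - (q *: 'X^i + R)).
  have /vN-> := h; move=> /(_ isT); by rewrite addrC subrK.
have t1 : t = 1.
  have : ~~ (C %| T) by apply/negP => /vN; rewrite hT.
  move=> /ram_val_dvd[z hz]; have := vval _ _ hz; rewrite hT => -[h].
  have : (`|t|%N * `|z|%N = 1)%N by rewrite -abszM -h.
  move/eqP; rewrite muln_eq1 => /andP[/eqP h1 _]; lia.
move=> P; case E: (ram_place P) => [z|].
  by move/ram_placeP: E => /vval ->; rewrite t1 mul1r.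
by case: ram_place_axioms => h _ _; move/h: E => /vN.
Qed.

End TotallyRamified.

(** * Points of the curve *)

Definition inj_poly (K : fieldType) (M : fraction_model {poly K}) :
  {rmorphism {poly K} -> {poly M}} := polyC \o fm_inj M.

Definition rad_poly (K : fieldType) (M : fraction_model {poly K}) (f : {poly K}) (d : nat)
  : {poly M} := 'X^d - (fm_inj M f)%:P.

Definition gplace (K : fieldType) (M : fraction_model {poly K}) (f : {poly K}) (d : nat)
    (v : {poly M} -> option int) : Prop :=
  [/\ (forall p, v p = None <-> rad_poly M f d %| p),
      (forall p q, v (p * q) = oi_add (v p) (v q)),
      (forall p q (z : int), oi_ge (v p) z -> oi_ge (v q) z -> oi_ge (v (p + q)) z),
      (forall c : K, c != 0 -> v (fm_inj M c%:P)%:P = Some 0)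
    & (exists t, v t = Some 1)].

(** * Residues in $K$ *)

Section Residue.
Variable K : fieldType.
Variable M : fraction_model {poly K}.
Local Notation FX := (fm_field M).
Local Notation tofrac := (fm_inj M).
Local Notation inj_poly := (inj_poly M).
Variable v : {poly FX} -> option int.
Hypothesis hv : pval v.
Hypothesis hc : forall c : K, c != 0 -> v (inj_poly c%:P) = Some 0.

Definition res (P : {poly FX}) (c : K) := oi_ge (v (P - inj_poly c%:P)) 1.

Lemma const_ge0 (c : K) : oi_ge (v (inj_poly c%:P)) 0.
Proof.
have [->|h] := eqVneq c 0; first by rewrite !rmorph0 (pval0 hv).
by rewrite hc.
Qed.

Lemma res_const c : res (inj_poly c%:P) c.
Proof. by rewrite /res subrr (pval0 hv). Qed.

Lemma res_ge0 P c : res P c -> oi_ge (v P) 0.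
Proof.
move=> h; rewrite -[P](subrK (inj_poly c%:P)); apply: (pval_geD hv).
  exact: oi_ge_le h.
exact: const_ge0.
Qed.

Lemma resD P Q c c' : res P c -> res Q c' -> res (P + Q) (c + c').
Proof.
rewrite /res => h h'; rewrite !rmorphD /=.
rewrite opprD addrACA. 
exact: (pval_geD hv).
Qed.

Lemma resM P Q c c' : res P c -> res Q c' -> res (P * Q) (c * c').
Proof.
move=> h h'; have h0 := res_ge0 h'; move: h h'; rewrite /res => h h'; rewrite !rmorphM /=.
have -> : P * Q - inj_poly c%:P * inj_poly c'%:P =
  (P - inj_poly c%:P) * Q + inj_poly c%:P * (Q - inj_poly c'%:P).
  by rewrite mulrBl mulrBr addrA subrK.
apply: (pval_geD hv); first by rewrite -[1]addr0; apply: (pval_geM hv).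
by rewrite -[1]add0r; apply: (pval_geM hv) => //; apply: const_ge0.
Qed.

Lemma resN P c : res P c -> res (- P) (- c).
Proof.
by rewrite /res !rmorphN /= -opprD (pvalN hv).
Qed.

Lemma resB P Q c c' : res P c -> res Q c' -> res (P - Q) (c - c').
Proof. by move=> h h'; apply: resD => //; apply: resN. Qed.

Lemma res0 : res 0 0.
Proof. by have := res_const 0; rewrite !rmorph0. Qed.

Lemma res1 : res 1 1.
Proof. by have := res_const 1; rewrite !rmorph1. Qed.

Lemma resX P c k : res P c -> res (P ^+ k) (c ^+ k).
Proof.
move=> h; elim: k => [|k IH]; first by rewrite !expr0; apply: res1.
by rewrite !exprS; apply: resM.
Qed.

Lemma res_sum (I : Type) (r : seq I) (pr : pred I) F G : (forall i, pr i -> res (F i) (G i)) ->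
  res (\sum_(i <- r | pr i) F i) (\sum_(i <- r | pr i) G i).
Proof.
move=> h; elim/big_rec2: _ => [|i x y Pi hxy]; first exact: res0.
by apply: resD => //; apply: h.
Qed.

Lemma res_unit P c : res P c -> c != 0 -> v P = Some 0.
Proof.
move=> h c0; rewrite -[P](subrK (inj_poly c%:P)) addrC.
by apply: (pvalD_dom hv); [apply: hc | ].
Qed.

Lemma res_pos P : oi_ge (v P) 1 = res P 0.
Proof. by rewrite /res !rmorph0 subr0. Qed.

Lemma res_uniq P c c' : res P c -> res P c' -> c = c'.
Proof.
move=> h h'; apply/eqP; rewrite -subr_eq0; apply: contraT => ne.
have := res_unit (resB (res_const c) (res_const c')) ne.
have -> : inj_poly c%:P - inj_poly c'%:P =
   (P - inj_poly c'%:P) - (P - inj_poly c%:P).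
  by rewrite opprB [RHS]addrC addrA subrK.
by move=> E; have := pval_geB hv h' h; rewrite E.
Qed.

Lemma res_poly a u : res (inj_poly 'X) a -> res (inj_poly u) u.[a].
Proof.
move=> h; elim/poly_ind: u => [|u c IH].
  by rewrite rmorph0 horner0; apply: res0.
rewrite rmorphD rmorphM /= !hornerE; apply: resD; last exact: res_const.
exact: resM.
Qed.

(** For the cofactor of $P-Q$ in $P^d-Q^d$: it is a unit when $d$ and $c$ are nonzero in $K$, and
    then $P^d-Q^d$ and $P-Q$ have the same value. *)
Lemma res_geom (d : nat) P Q c : res P c -> res Q c ->
  res (\sum_(i < d) P ^+ (d.-1 - i) * Q ^+ i) (d%:R * c ^+ d.-1).
Proof.
move=> h h'; have -> : d%:R * c ^+ d.-1 = \sum_(i < d) c ^+ (d.-1 - i) * c ^+ i.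
  rewrite (eq_bigr (fun _ => c ^+ d.-1)) ?sumr_const ?card_ord ?mulr_natl // => i _.
  by rewrite -exprD subnK //; have := ltn_ord i; lia.
by apply: res_sum => i _; apply: resM; apply: resX.
Qed.

End Residue.

(** * Restriction of a place to $K(x)$ *)

Section PlaceRestriction.
Variable K : fieldType.
Variable M : fraction_model {poly K}.
Local Notation FX := (fm_field M).
Local Notation tofrac := (fm_inj M).
Local Notation inj_poly := (inj_poly M).
Variables (f : {poly K}) (d : nat) (v : {poly FX} -> option int).
Hypothesis d_gt0 : (0 < d)%N.
Hypothesis vP : gplace f d v.
Let C := rad_poly M f d.

Lemma size_rad_poly : size C = d.+1.
Proof. by rewrite /C /rad_poly size_XnsubC. Qed.

Lemma place_None P : v P = None <-> C %| P.
Proof. by case: vP. Qed.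

Lemma place_some P : ~~ (C %| P) -> exists z, v P = Some z.
Proof.
case E: (v P) => [z|]; first by exists z.
by move/place_None: E => ->.
Qed.

Lemma rad_poly_ndvd_small (P : {poly FX}) : P != 0 -> (size P <= d)%N -> ~~ (C %| P).
Proof.
move=> P0 hP; apply/negP => /dvdp_leq - /(_ P0).
by rewrite size_rad_poly leqNgt ltnS hP.
Qed.

Lemma rad_poly_ndvdC (q : FX) : q != 0 -> ~~ (C %| q%:P).
Proof. by move=> q0; apply: rad_poly_ndvd_small; rewrite ?polyC_eq0 // size_polyC q0. Qed.

Lemma place_pval : pval v.
Proof.
case: vP => h1 h2 h3 h4 [t ht]; split=> //; first by apply/h1; apply: dvdp0.
have [z hz] := place_some (rad_poly_ndvdC (oner_neq0 _)).
move: (h2 1%:P t); rewrite mul1r ht hz /= => -[h].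
congr Some; lia.
Qed.

Lemma place_const (c : K) : c != 0 -> v (inj_poly c%:P) = Some 0.
Proof. by case: vP => _ _ _ h _; apply: h. Qed.

Lemma place_polyC (q : FX) : q != 0 -> exists z, v q%:P = Some z.
Proof. by move=> /rad_poly_ndvdC/place_some. Qed.

Lemma place_modD P Q : C %| Q -> v (P + Q) = v P.
Proof.
move=> hQ; have E : v Q = None by apply/place_None.
case EP: (v P) => [z|].
  by apply: (pvalD_dom place_pval) => //; rewrite E.
by apply/place_None; apply: dvdp_add => //; apply/place_None.
Qed.

Lemma place_eqmod P Q : C %| P - Q -> v P = v Q.
Proof. by move=> /(place_modD Q); rewrite addrC subrK. Qed.

Lemma place_fval (mu : {poly K} -> int) (c : int) :
  (forall u u', u != 0 -> u' != 0 -> mu (u * u') = mu u + mu u') ->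
  (forall u, u != 0 -> v (inj_poly u) = Some (c * mu u)) ->
  forall q x, fval mu q = Some x -> v q%:P = Some (c * x).
Proof.
move=> muM h q x; elim/fval_ind: q => [|u u' hu hu'].
  by rewrite /fval eqxx.
rewrite fvalE // => -[<-].
have hw := pval_comp (polyC : {rmorphism FX -> {poly FX}}) place_pval.
have /= -> := pvalMs hw (h _ hu) (pval_inv hw (h _ hu')); congr Some; ring.
Qed.

Lemma place_fin_res a : oi_ge (v (inj_poly ('X - a%:P))) 1 -> res v (inj_poly 'X) a.
Proof. by rewrite rmorphB. Qed.

(** A nonzero polynomial is a power of $x-a$ times one that does not vanish at [a]; the latter has a
    nonzero residue, hence value 0. *)
Lemma place_fin_val a c : v (inj_poly ('X - a%:P)) = Some c -> 0 < c ->
  forall q x, ord_at a q = Some x -> v q%:P = Some (c * x).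
Proof.
move=> hc c0; apply: place_fval; first exact: mup_intM.
move=> u u0; have := mup_geq a (mup a u) u0; rewrite leqnn => /esym /dvdpP[p E].
have pa : p.[a] != 0.
  apply/negP => /eqP /eqP r; have : ('X - a%:P) ^+ (mup a u).+1 %| u.
    rewrite {2}E exprS dvdp_mul2r ?dvdp_XsubCl // expf_neq0 // polyXsubC_eq0 //.
  by rewrite -mup_geq // ltnn.
have ra : res v (inj_poly 'X) a.
  by apply: place_fin_res; rewrite hc /=; lia.
have vp := res_unit place_pval place_const (res_poly place_pval place_const p ra) pa.
rewrite {1}E rmorphM rmorphXn /= (pvalMs place_pval vp (pvalX place_pval _ hc)).
by rewrite add0r.
Qed.

Lemma place_oo_val c : v (inj_poly 'X) = Some (- c) -> 0 < c ->
  forall q x, ord_oo q = Some x -> v q%:P = Some (c * x).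
Proof.
move=> hc c0; apply: place_fval; first exact: degNM.
elim/poly_ind => [|u k IH]; first by rewrite eqxx.
have [-> |u0 _] := eqVneq u 0.
  rewrite mul0r add0r polyC_eq0 => k0; rewrite place_const // /degN size_polyC k0.
  by rewrite mulr0.
rewrite rmorphD rmorphM /=.
have h1 := pvalMs place_pval (IH u0) hc.
have su : (0 < size u)%N by rewrite size_poly_gt0.
have -> : c * degN (u * 'X + k%:P) = c * degN u + - c.
  rewrite /degN size_MXaddC (negbTE u0) /= ; case: (size u) su => // s _ /=.
  by rewrite -addn1 PoszD; ring.
apply: (pvalD_dom place_pval h1).
apply: oi_ge_le (const_ge0 place_pval place_const k).
rewrite /degN; have : 0 <= c * (size u).-1%:Z by apply: mulr_ge0; lia.
by rewrite mulrN; lia.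
Qed.

End PlaceRestriction.

(** Evaluation of [P] is bounded and Lipschitz on arguments of nonnegative value, with a constant
    depending on [P] alone. Composition is used so that the arguments may be both $Y$ itself and
    truncated power series in $x-a$. *)
Lemma comp_poly_bound (F : fieldType) (v : {poly F} -> option int) (P : {poly F}) :
  pval v -> exists b : nat, forall Z Z', oi_ge (v Z) 0 -> oi_ge (v Z') 0 ->
    oi_ge (v (P \Po Z)) (- b%:Z) /\
    forall N : int, 0 <= N -> oi_ge (v (Z - Z')) N -> oi_ge (v ((P \Po Z) - (P \Po Z'))) (N - b%:Z).
Proof.
move=> hv; elim/poly_ind: P => [|P c [b hb]].
  exists 0%N => Z Z' _ _; rewrite !comp_poly0 subrr; split=> [|N _ _]; apply: (pval_ge0 hv).
have [b' hb'] : exists b' : nat, oi_ge (v c%:P) (- b'%:Z).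
  case: (v c%:P) => [x|]; last by exists 0%N.
  by exists `|x|%N => /=; lia.
exists (b + b')%N => Z Z' hZ hZ'; have [h1 h2] := hb Z Z' hZ hZ'.
have [h3 _] := hb Z' Z hZ' hZ.
rewrite !comp_poly_MXaddC; split.
  apply: (pval_geD hv); last by apply: oi_ge_le hb'; lia.
  by apply: oi_ge_le (pval_geM hv h1 hZ); lia.
move=> N N0 hN; have := h2 N N0 hN.
set p := P \Po Z; set p' := P \Po Z' in h3 * => h4.
have -> : p * Z + c%:P - (p' * Z' + c%:P) = (p - p') * Z + p' * (Z - Z') by ring.
apply: (pval_geD hv).
  by apply: oi_ge_le (pval_geM hv h4 hZ); lia.
by apply: oi_ge_le (pval_geM hv h3 hN); lia.
Qed.

(** * Points with $y\ne 0$: the unramified places *)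

Section Unramified.
Variable K : fieldType.
Variable M : fraction_model {poly K}.
Local Notation FX := (fm_field M).
Local Notation tofrac := (fm_inj M).
Local Notation inj_poly := (inj_poly M).
Variables (f : {poly K}) (d : nat) (a b : K).
Hypothesis d_gt1 : (1 < d)%N.
Hypothesis dK : d%:R != 0 :> K.
Hypothesis b0 : b != 0.
Hypothesis fab : f.[a] = b ^+ d.
Let C := rad_poly M f d.
Hypothesis Cprime : forall P Q, C %| P * Q -> (C %| P) || (C %| Q).
Let w := @ord_at _ M a.
Let hw : pval w := ord_at_pval M a.

(* Truncations of the power series y = f^(1/d) at a with constant term b; the place
   at the point (a, b) is the order at a along this branch. *)
Definition hensel (N : nat) (Y : {poly K}) := Y.[a] = b /\ ('X - a%:P) ^+ N %| Y ^+ d - f.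

Lemma horner_geom Y Y' : Y.[a] = b -> Y'.[a] = b ->
  (\sum_(i < d) Y ^+ (d.-1 - i) * Y' ^+ i).[a] = d%:R * b ^+ d.-1.
Proof.
move=> h h'; rewrite horner_sum (eq_bigr (fun _ => b ^+ d.-1)) ?sumr_const ?card_ord ?mulr_natl //.
move=> i _; rewrite hornerM !horner_exp h h' -exprD subnK //; have := ltn_ord i; lia.
Qed.

Lemma geom_neq0 : d%:R * b ^+ d.-1 != 0.
Proof. by rewrite mulf_neq0 // expf_neq0. Qed.

Lemma hensel_le N N' Y : (N' <= N)%N -> hensel N Y -> hensel N' Y.
Proof. by move=> h [h1 h2]; split=> //; apply: dvdp_trans h2; apply: dvdp_exp2l. Qed.

Lemma hensel_exists N : exists Y, hensel N Y.
Proof.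
suff [Y hY] : exists Y, hensel N.+1 Y by exists Y; apply: hensel_le hY.
elim: N => [|N [Y [hY /dvdpP[G EG]]]].
  exists b%:P; split; first by rewrite hornerC.
  by rewrite expr1 dvdp_XsubCl rootE !hornerE fab subrr.
(* Newton correction: adding $c(x-a)^{N+1}$ to $Y$ changes $Y^d$ by $d\,b^{d-1}c\,(x-a)^{N+1}$ up to
   higher order, which must cancel $G(a)(x-a)^{N+1}$. *)
pose c := - G.[a] / (d%:R * b ^+ d.-1).
pose Y' := Y + c%:P * ('X - a%:P) ^+ N.+1.
have hY' : Y'.[a] = b by rewrite /Y' !hornerE hY subrr expr0n /= mulr0 addr0.
exists Y'; split=> //.
have -> : Y' ^+ d - f = (Y' ^+ d - Y ^+ d) + (Y ^+ d - f) by ring.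
rewrite EG subrXX; have -> : Y' - Y = c%:P * ('X - a%:P) ^+ N.+1 by rewrite /Y' addrC addKr.
set S := \sum_(i < d) _; rewrite mulrAC -mulrDl exprS dvdp_mul2r; last first.
  by rewrite expf_neq0 // polyXsubC_eq0.
rewrite dvdp_XsubCl rootE hornerD hornerM hornerC horner_geom //.
by rewrite divfK ?geom_neq0 // addNr.
Qed.

(** The cofactor of $Y-Y'$ in $Y^d-Y'^d$ takes the value $d\,b^{d-1}\ne 0$ at [a], so it is prime to
    $x-a$. *)
Lemma hensel_cong N Y Y' : hensel N Y -> hensel N Y' -> ('X - a%:P) ^+ N %| Y - Y'.
Proof.
move=> [h1 h2] [h1' h2'].
have := dvdp_sub h2 h2'.
have -> : Y ^+ d - f - (Y' ^+ d - f) = Y ^+ d - Y' ^+ d by ring.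
rewrite subrXX Gauss_dvdpl //; apply: coprimep_expl.
by rewrite coprimep_sym coprimep_XsubC rootE horner_geom // geom_neq0.
Qed.

(** The power series is never formed; its order is the value on which all sufficiently precise
    truncations agree. *)
Definition unr_val (P : {poly FX}) (z : int) := exists N0, forall N Y,
  (N0 <= N)%N -> hensel N Y -> w P.[tofrac Y] = Some z.

Lemma hensel_dvd Q : C %| Q -> exists b : nat, forall N Y, hensel N Y ->
  oi_ge (w Q.[tofrac Y]) (N%:Z - b%:Z).
Proof.
case/dvdpP=> B ->.
have hv := pval_comp (horner_eval (0 : FX)) hw.
have [k hk] := comp_poly_bound B hv; exists k => N Y [h1 h2].
have hY : oi_ge ((w \o horner_eval 0) (inj_poly Y)) 0.
  by rewrite /= /horner_eval hornerC; apply: ord_at_ge0.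
have [h3 _] := hk _ _ hY hY; move: h3; rewrite comp_polyCr /= /horner_eval hornerC => h3.
rewrite hornerM addrC; apply: (pval_geM hw) => //.
by rewrite /C /rad_poly !hornerE -rmorphXn -rmorphB /=; apply: ord_at_ge.
Qed.

Lemma unr_val_fun P z z' : unr_val P z -> unr_val P z' -> z = z'.
Proof.
move=> [N h] [N' h']; have [Y hY] := hensel_exists (maxn N N').
have := h _ _ (leq_maxl _ _) hY; rewrite (h' _ _ (leq_maxr _ _) hY).
by case.
Qed.

Lemma unr_valM P Q z z' : unr_val P z -> unr_val Q z' -> unr_val (P * Q) (z + z').
Proof.
move=> [N h] [N' h']; exists (maxn N N') => N2 Y; rewrite geq_max => /andP[hM hM'] hY.
by rewrite hornerM; apply: (pvalMs hw); [apply: h hM hY | apply: h' hM' hY].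
Qed.

Lemma unr_valD P Q z z' z'' t : unr_val P z -> unr_val Q z' -> unr_val (P + Q) z'' ->
  t <= z -> t <= z' -> t <= z''.
Proof.
move=> [N h] [N' h'] [N'' h''] tz tz'.
have [Y hY] := hensel_exists (maxn (maxn N N') N'').
have E := h'' _ _ (leq_maxr _ _) hY.
have l1 : (N <= maxn (maxn N N') N'')%N by lia.
have l2 : (N' <= maxn (maxn N N') N'')%N by lia.
have : oi_ge (w (P + Q).[tofrac Y]) t; last by rewrite E.
by rewrite hornerD; apply: (pval_geD hw); rewrite ?(h _ _ l1 hY) ?(h' _ _ l2 hY).
Qed.

Lemma unr_val_mod P Q z : unr_val P z -> C %| Q -> unr_val (P + Q) z.
Proof.
move=> [N h] /hensel_dvd[k hk]; exists (maxn N (`|z| + k + 1)%N) => N2 Y.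
rewrite geq_max => /andP[hM hM'] hY; rewrite hornerD.
apply: (pvalD_dom hw); first exact: h hM hY.
by apply: oi_ge_le (hk _ _ hY); lia.
Qed.

Lemma rad_poly_coprime (P : {poly FX}) : ~~ (C %| P) -> coprimep P C.
Proof.
clear dK b0 fab => hP; have := dvdp_gcdr P C => /dvdpP[k Ek].
have C0 : C != 0 by rewrite -size_poly_gt0 size_rad_poly ?(ltnW d_gt1).
have := Cprime (P := k) (Q := gcdp P C); rewrite -Ek dvdpp => /(_ isT) /orP[] h; last first.
  by case/negP: hP; apply: dvdp_trans h (dvdp_gcdl _ _).
have k0 : k != 0 by apply: contraNneq C0 => k0; rewrite Ek k0 mul0r.
have g0 : gcdp P C != 0 by apply: contraNneq C0 => g0; rewrite Ek g0 mulr0.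
have := dvdp_leq k0 h; rewrite {1}Ek size_mul //.
rewrite /coprimep; move: g0; rewrite -size_poly_gt0; move: k0; rewrite -size_poly_gt0.
by lia.
Qed.

(** In a relation $u_1P+u_2C=1$ the second term is small on precise truncations, so a lower bound
    $-k_1$ for $u_1$ gives the upper bound $k_1$ for the order of $P$. Passing to finer truncations
    changes $P$ only by terms of order above $k_1$, so its order is stable. *)
Lemma unr_val_dvd P : (exists z, unr_val P z) <-> ~~ (C %| P).
Proof.
split=> [[z [N h]]|hP].
  apply/negP => /hensel_dvd[k hk].
  have [Y hY] := hensel_exists (maxn N (`|z| + k + 1)%N).
  by have := hk _ _ hY; rewrite (h _ _ _ hY) ?leq_maxl //=; lia.
have /Bezout_eq1_coprimepP[[u1 u2] /= E] := rad_poly_coprime hP.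
have hv := pval_comp (horner_eval (0 : FX)) hw.
have hY0 Y : oi_ge ((w \o horner_eval 0) (inj_poly Y)) 0.
  by rewrite /= /horner_eval hornerC; apply: ord_at_ge0.
have [k1 hk1] := comp_poly_bound u1 hv.
have [k2 hk2] := hensel_dvd (dvdp_mull u2 (dvdpp C)).
have [k3 hk3] := comp_poly_bound P hv.
pose N0 := (k1 + k2 + k3 + 1)%N.
have [Y0 hY] := hensel_exists N0.
have [z hz hz1] : exists2 z, w P.[tofrac Y0] = Some z & z <= k1%:Z.
  have [h1 _] := hk1 _ _ (hY0 Y0) (hY0 Y0).
  move: h1; rewrite comp_polyCr /= /horner_eval hornerC => h1.
  have h2 := hk2 _ _ hY.
  have E1 : u1.[tofrac Y0] * P.[tofrac Y0] = 1 - (u2 * C).[tofrac Y0].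
    have := congr1 (fun p => p.[tofrac Y0]) E; rewrite hornerD -polyC1 hornerC => <-.
    by rewrite -hornerM addrK.
  have : w (u1.[tofrac Y0] * P.[tofrac Y0]) = Some 0.
    rewrite E1; apply: (pvalD_dom hw (pval1 hw)); rewrite (pvalN hw).
    by apply: oi_ge_le h2; rewrite /N0; lia.
  rewrite (pvalM hw); move: h1; case: (w u1.[_]) => [x|] //=; case: (w P.[_]) => [y|] //= h1 [h3].
  by exists y => //; lia.
exists z, N0 => N Y hN hYN.
have hd := hensel_cong (hensel_le hN hYN) hY.
have [_ h3] := hk3 _ _ (hY0 Y) (hY0 Y0).
have := h3 N0%:Z (le0z_nat _); rewrite !comp_polyCr -rmorphB /= /horner_eval !hornerC -!rmorphB /=.
rewrite hornerC => /(_ (ord_at_ge M hd)) h4.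
rewrite -[P.[_]](subrK P.[tofrac Y0]) addrC; apply: (pvalD_dom hw) => //.
by apply: oi_ge_le h4; rewrite /N0; lia.
Qed.

Definition unr_place := val_of unr_val.

Lemma unr_placeP P z : unr_place P = Some z <-> unr_val P z.
Proof. exact: (val_ofP unr_val_fun). Qed.

Lemma unr_place_polyC q x : w q = Some x -> unr_place q%:P = Some x.
Proof. by move=> hq; apply/unr_placeP; exists 0%N => N Y _ _; rewrite hornerC. Qed.

Lemma unr_place_gplace : gplace f d unr_place.
Proof.
split.
- exact: (val_of_None unr_val_fun unr_val_dvd).
- exact: (val_ofM unr_val_fun unr_val_dvd unr_valM).
- exact: (val_ofD unr_val_fun unr_val_dvd unr_valD unr_val_mod).
- move=> c c0; apply: unr_place_polyC.
  by rewrite /w ord_at_tofrac ?polyC_eq0 // mupNroot // rootC.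
- by exists (inj_poly ('X - a%:P)); apply: unr_place_polyC; apply: ord_at_XsubC.
Qed.

Lemma unr_place_x : unr_place (inj_poly ('X - a%:P)) = Some 1.
Proof. by apply: unr_place_polyC; apply: ord_at_XsubC. Qed.

Lemma unr_place_y : res unr_place 'X b.
Proof.
rewrite /res; have hn : ~~ (C %| 'X - inj_poly b%:P).
  apply: rad_poly_ndvd_small; rewrite ?(ltnW d_gt1) ?polyXsubC_eq0 //.
  by rewrite size_XsubC.
have [z hz] := place_some unr_place_gplace hn; rewrite hz /=.
move/unr_placeP: hz => [N h]; have [Y hY] := hensel_exists N.
have := h _ _ (leqnn _) hY; rewrite !hornerE -rmorphB /= => E.
have := @ord_at_ge _ M a (Y - b%:P) 1; rewrite dvdp_XsubCl rootE !hornerE.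
by case: hY => -> _; rewrite subrr eqxx => /(_ isT); rewrite -/w E.
Qed.

(** On $K(x)$ such a [v] is a positive multiple [c] of the order at [a]. For a truncation $T$ the
    difference $Y^d-T^d$ is $f-T^d$ modulo [C], and its cofactor over $Y-T$ is a unit, so $Y$ is
    close to $T$ for [v]. Hence $P$ and $P(T)$ have the same value, and an element of value 1 gives
    $c=1$. *)
Lemma unr_place_uniq v : gplace f d v -> oi_ge (v (inj_poly ('X - a%:P))) 1 ->
  res v 'X b -> forall P, v P = unr_place P.
Proof.
move=> vP hx hy; have hv := place_pval (ltnW d_gt1) vP.
have hc := place_const vP.
have X0 : tofrac ('X - a%:P) != 0 by rewrite fm_eq0 polyXsubC_eq0.
have [c Ec] := place_polyC (ltnW d_gt1) vP X0.
have c0 : 0 < c by move: hx; rewrite /inj_poly Ec /=; lia.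
have hvw := place_fin_val (ltnW d_gt1) vP Ec c0.
have vval P z : unr_val P z -> v P = Some (c * z).
  move=> [N0 h]; have [k hk] := comp_poly_bound P hv.
  pose N := (N0 + k + `|(c * z)%R| + 1)%N.
  have [Y hY] := hensel_exists N.
  have hY0 : res v (inj_poly Y) b.
    case: (hY) => <- _; apply: (res_poly hv hc); exact: place_fin_res.
  have [_ h2] := hk 'X (inj_poly Y) (res_ge0 hv hc hy) (res_ge0 hv hc hY0).
  have := h2 N%:Z (le0z_nat _); rewrite comp_polyXr comp_polyCr => h3.
  have EP : v (P.[tofrac Y])%:P = Some (c * z).
    by apply: hvw; apply: h hY; rewrite /N; lia.
  rewrite -[P](subrK P.[tofrac Y]%:P) addrC; apply: (pvalD_dom hv) => //.
  apply: oi_ge_le (h3 _); first by rewrite /N; lia.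
  have hG := res_unit hv hc (res_geom hv hc d hy hY0) geom_neq0.
  have E2 : v ('X^d - inj_poly Y ^+ d) = v ('X - inj_poly Y).
    rewrite subrXX (pvalM hv) hG; by case: (v ('X - _)) => //= x; rewrite addr0.
  rewrite -E2.
  have -> : 'X^d - inj_poly Y ^+ d = C - inj_poly (Y ^+ d - f).
    by rewrite /C /rad_poly rmorphB rmorphXn /= opprB addrA subrK.
  apply: (pval_geB hv).
    by have /(place_None vP)-> : C %| C by [].
  case E: (w (tofrac (Y ^+ d - f))) => [x|].
    rewrite /inj_poly (hvw _ _ E) /=.
    case: hY => _ /(ord_at_ge M); rewrite -/w E /= => hx'.
    have : 0 <= (c - 1) * x by apply: mulr_ge0; lia.
    by rewrite mulrBl mul1r; lia.
move/ord_at_None: E => E; have -> : inj_poly (Y ^+ d - f) = 0 by rewrite /= E.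
  exact: (pval_ge0 hv).
have [T hT] : exists t, v t = Some 1 by case: vP.
have c1 : c = 1.
  have : ~~ (C %| T) by apply/negP => /(place_None vP); rewrite hT.
  move=> /unr_val_dvd[z hz]; have := vval _ _ hz; rewrite hT => -[h].
  have : (`|c|%N * `|z|%N = 1)%N by rewrite -abszM -h.
  move/eqP; rewrite muln_eq1 => /andP[/eqP h1 _]; lia.
move=> P; case E: (unr_place P) => [z|].
  by move/unr_placeP: E => /vval ->; rewrite c1 mul1r.
by apply/(place_None vP)/(place_None unr_place_gplace).
Qed.

End Unramified.

(** * Roots and leading terms of polynomials *)

Lemma double_root (F : fieldType) (p : {poly F}) (a : F) :
  ('X - a%:P) ^+ 2 %| p -> root p a /\ root p^`() a.
Proof.
case/dvdpP=> q ->; split; first by rewrite rootE !hornerE subrr /= !mulr0.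
have : ('X - a%:P).[a] = 0 by rewrite hornerXsubC subrr.
move: ('X - a%:P) => t t0; rewrite rootE expr2 !derivM !(hornerD, hornerM) t0.
by rewrite !(mulr0, mul0r, addr0) eqxx.
Qed.

Lemma mup_eq1 (F : fieldType) (p : {poly F}) (a : F) :
  p != 0 -> root p a -> ~~ (('X - a%:P) ^+ 2 %| p) -> mup a p = 1%N.
Proof.
move=> p0 ra; rewrite -mup_ltn // => h.
by have := XsubC_dvd a p0; rewrite dvdp_XsubCl ra; lia.
Qed.

Lemma closed_dth_root (K : closedFieldType) (d : nat) (c : K) : (0 < d)%N -> exists b, b ^+ d = c.
Proof.
move=> d0; have /closed_rootP[b] : size ('X^d - c%:P : {poly K}) != 1%N.
  by rewrite size_XnsubC //; lia.
by rewrite rootE !hornerE subr_eq0 => /eqP; exists b.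
Qed.

(** A repeated root of $X^d-c$ would be a root of $dX^{d-1}$, hence 0, against $c\ne 0$. *)
Lemma radical_roots (K : closedFieldType) (d : nat) (c : K) : (0 < d)%N -> d%:R != 0 :> K ->
  c != 0 -> exists rs : seq K, [/\ uniq rs, size rs = d & forall b, b \in rs -> b ^+ d = c].
Proof.
move=> d0 dK c0; set p : {poly K} := 'X^d - c%:P.
have [rs E] := closed_field_poly_normal p.
have lp : lead_coef p = 1 by rewrite lead_coefXnsubC.
rewrite lp scale1r in E.
have p0 : p != 0 by rewrite -size_poly_gt0 size_XnsubC.
have hr b : b \in rs -> b ^+ d = c.
  move=> hb; have : root p b by rewrite E root_prod_XsubC.
  by rewrite rootE !hornerE subr_eq0 => /eqP.
exists rs; split=> //; last first.
  by have := size_XnsubC c d0; rewrite -/p E size_prod_XsubC => -[].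
apply: count_mem_uniq => b; rewrite -mu_prod_XsubC -E.
have [hb|hb] := boolP (b \in rs); last first.
  by rewrite mupNroot // E root_prod_XsubC.
apply: mup_eq1 => //; first by rewrite E root_prod_XsubC.
apply/negP => /double_root[_]; rewrite rootE derivB derivXn derivC subr0 hornerMn horner_exp hornerX.
rewrite -mulr_natl mulf_eq0 (negbTE dK) /= expf_eq0 => /andP[_ /eqP b0].
by move: (hr _ hb); rewrite b0 expr0n => h; rewrite -h gtn_eqF ?eqxx // in c0.
Qed.

Lemma root_unique_pow (K : closedFieldType) (p : {poly K}) (a : K) :
  (forall x, root p x -> x = a) -> p = lead_coef p *: ('X - a%:P) ^+ (size p).-1.
Proof.
have [->|p0] := eqVneq p 0; first by rewrite lead_coef0 scale0r.
move=> h; have [rs E] := closed_field_poly_normal p.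
have hrs : all (pred1 a) rs.
  apply/allP => x hx; apply/eqP/h; rewrite E rootZ ?lead_coef_eq0 //.
  by rewrite root_prod_XsubC.
have sE : size p = (size rs).+1.
  by rewrite E size_scale ?lead_coef_eq0 // size_prod_XsubC.
rewrite {1}E sE /=; congr (_ *: _); move/all_pred1P: hrs => ->.
by rewrite size_nseq big_nseq -Monoid.iteropE.
Qed.

(** All $d$ summands have degree $(d-1)k$ and leading coefficient $e^{d-1}$; the top terms add up to
    $d\,e^{d-1}$, which is assumed nonzero, so nothing cancels. *)
Lemma geom_lead (R : idomainType) (A B : {poly R}) (k d : nat) (e : R) : (0 < d)%N ->
  size A = k.+1 -> size B = k.+1 -> lead_coef A = e -> lead_coef B = e ->
  d%:R * e ^+ d.-1 != 0 ->
  let S := \sum_(i < d) A ^+ (d.-1 - i) * B ^+ i in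
  size S = (d.-1 * k).+1 /\ lead_coef S = d%:R * e ^+ d.-1.
Proof.
move=> d0 sA sB lA lB h S.
have A0 : A != 0 by rewrite -size_poly_gt0 sA.
have B0 : B != 0 by rewrite -size_poly_gt0 sB.
have sT (i : 'I_d) : size (A ^+ (d.-1 - i) * B ^+ i) = (d.-1 * k).+1 /\
    lead_coef (A ^+ (d.-1 - i) * B ^+ i) = e ^+ d.-1.
  have hi : (d.-1 - i + i)%N = d.-1 by have := ltn_ord i; lia.
  have nA : A ^+ (d.-1 - i) != 0 by rewrite expf_neq0.
  have nB : B ^+ i != 0 by rewrite expf_neq0.
  split; last by rewrite lead_coefM !lead_coef_exp lA lB -exprD hi.
  have sA' := size_exp A (d.-1 - i); have sB' := size_exp B i.
  rewrite sA /= in sA'; rewrite sB /= in sB'.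
  rewrite size_mul //; move: nA nB; rewrite -!size_poly_gt0.
  rewrite -{3}hi mulnDl mulnC [(i * k)%N]mulnC -sA' -sB'.
  by case: (size (A ^+ _)) => // x; case: (size (B ^+ _)) => // y _ _; rewrite addSn addnS.
have cS : S`_(d.-1 * k) = d%:R * e ^+ d.-1.
  rewrite coef_sum (eq_bigr (fun _ => e ^+ d.-1)) ?sumr_const ?card_ord ?mulr_natl //.
  by move=> i _; have [h1 h2] := sT i; rewrite -h2 lead_coefE h1.
have sS : size S = (d.-1 * k).+1.
  apply/eqP; rewrite eqn_leq; apply/andP; split.
    apply: leq_trans (size_sum _ _ _) _; apply/bigmax_leqP => i _.
    by have [-> _] := sT i.
  by apply: contraTT h; rewrite -ltnNge ltnS => hs; rewrite -cS nth_default ?eqxx.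
by split=> //; rewrite lead_coefE sS.
Qed.

Lemma indicT P : P -> indic P = 1.
Proof. by move=> h; rewrite /indic; case: excluded_middle_informative. Qed.

Lemma indicF P : ~ P -> indic P = 0.
Proof. by move=> h; rewrite /indic; case: excluded_middle_informative. Qed.

(** * Classification of the places of the curve *)

Section CurvePlaces.
Variables (K : closedFieldType) (M : fraction_model {poly K}).
Local Notation FX := (fm_field M).
Local Notation tofrac := (fm_inj M).
Local Notation inj_poly := (inj_poly M).
Variables (f : {poly K}) (d n : nat).
Hypothesis d_gt1 : (1 < d)%N.
Hypothesis dK : d%:R != 0 :> K.
Hypothesis cop : coprime n d.
Hypothesis size_f : size f = n.+1.
Hypothesis f_norep : no_repeated_roots f.
Let C := rad_poly M f d.
Let d_gt0 : (0 < d)%N := ltnW d_gt1.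

Lemma f_neq0 : f != 0.
Proof. by rewrite -size_poly_gt0 size_f. Qed.

Let cop_oo : coprime d `|- n%:Z|%N.
Proof. by rewrite abszN absz_nat coprime_sym. Qed.

Lemma ord_oo_f : @ord_oo _ M (tofrac f) = Some (- n%:Z).
Proof. by rewrite ord_oo_tofrac ?f_neq0 // size_f. Qed.

Lemma rad_poly_prime P Q : C %| P * Q -> (C %| P) || (C %| Q).
Proof.
exact: (radical_prime (ord_oo_pval M) (@ord_oo_None _ M) d_gt0 ord_oo_f cop_oo).
Qed.

Definition place_oo : {poly M} -> option int :=
  ram_place (@ord_oo _ M) (tofrac f) d (- n%:Z).

Lemma place_ooC q x : ord_oo q = Some x -> place_oo q%:P = Some (d%:Z * x).
Proof.
exact: (ram_place_polyC (ord_oo_pval M) (@ord_oo_None _ M) d_gt0 ord_oo_f).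
Qed.

Lemma place_ooX : place_oo 'X = Some (- n%:Z).
Proof. exact: (ram_place_X (ord_oo_pval M) (@ord_oo_None _ M) d_gt0 ord_oo_f). Qed.

Lemma place_oo_poly u : u != 0 -> place_oo (inj_poly u) = Some (- (d * (size u).-1)%N%:Z).
Proof.
by move=> u0; rewrite (place_ooC (ord_oo_tofrac M u0)) mulrN PoszM.
Qed.

Lemma place_oo_gplace : gplace f d place_oo.
Proof.
have [h1 h2 h3] := ram_place_axioms (ord_oo_pval M) (@ord_oo_None _ M) d_gt0 ord_oo_f cop_oo.
split=> //.
  by move=> c c0; rewrite (@place_oo_poly c%:P) ?polyC_eq0 // size_polyC c0 muln0.
apply: (ram_place_unif (ord_oo_pval M) (@ord_oo_None _ M) d_gt0 ord_oo_f cop_oo).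
by apply: (pval_surj (q := tofrac 'X) (ord_oo_pval M)); right; apply: ord_oo_X.
Qed.

Lemma place_oo_coef P z j : oi_ge (place_oo P) z ->
  oi_ge (omap (fun x => d%:Z * x + - n%:Z * j%:Z) (ord_oo (P %% C)`_j)) z.
Proof.
exact: (ram_place_coef (ord_oo_pval M) (@ord_oo_None _ M) d_gt0 ord_oo_f cop_oo).
Qed.

Definition at_oo (v : {poly M} -> option int) : Prop :=
  exists z : int, v (inj_poly 'X) = Some z /\ z < 0.

Lemma place_oo_at_oo : at_oo place_oo.
Proof.
exists (- d%:Z); rewrite place_oo_poly ?polyX_eq0 // size_polyX muln1; split=> //.
by lia.
Qed.

Lemma at_oo_uniq v : gplace f d v -> at_oo v -> forall P, v P = place_oo P.
Proof.
move=> vP [z [hz z0]].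
have hz' : v (inj_poly 'X) = Some (- (- z)) by rewrite opprK.
have c0 : 0 < - z by lia.
have := ram_place_uniq (ord_oo_pval M) (@ord_oo_None _ M) d_gt0 ord_oo_f cop_oo
  (place_pval d_gt0 vP) (place_None vP) c0 (place_oo_val d_gt0 vP hz' c0).
by apply; case: vP.
Qed.

Definition above v (a b : K) : Prop :=
  [/\ gplace f d v, oi_ge (v (inj_poly ('X - a%:P))) 1 & res v 'X b].

Lemma rad_polyE : 'X^d = inj_poly f + C.
Proof. by rewrite /C /rad_poly addrC subrK. Qed.

Lemma place_Xd v : gplace f d v -> forall P, v (P * 'X^d) = v (P * inj_poly f).
Proof.
move=> vP P; rewrite rad_polyE mulrDr (place_modD d_gt0 vP) //.
by rewrite dvdp_mull.
Qed.

Section Above.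
Variables (v : {poly M} -> option int) (a b : K).
Hypothesis hab : above v a b.
Let vP : gplace f d v. Proof. by case: hab. Qed.
Let hv := place_pval d_gt0 vP.
Let hc := place_const vP.

Lemma above_x : res v (inj_poly 'X) a.
Proof. by apply: place_fin_res; case: hab. Qed.

Lemma above_y : res v 'X b.
Proof. by case: hab. Qed.

Lemma above_poly u : res v (inj_poly u) u.[a].
Proof. exact: (res_poly hv hc u above_x). Qed.

Lemma above_eq : f.[a] = b ^+ d.
Proof.
have h1 := resX hv hc d above_y; have h2 := above_poly f.
apply: (res_uniq hv hc h2); move: h1; rewrite /res rad_polyE addrAC.
by rewrite (place_modD d_gt0 vP) // dvdpp.
Qed.

Lemma above_fin : ~ at_oo v.
Proof.
by move=> [z [hz z0]]; have := res_ge0 hv hc above_x; rewrite hz /=; lia.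
Qed.

Lemma above_uniq a' b' : above v a' b' -> a = a' /\ b = b'.
Proof.
move=> [_ h1 h2]; split.
  exact: (res_uniq hv hc above_x (place_fin_res h1)).
exact: (res_uniq hv hc above_y h2).
Qed.

End Above.

Lemma ord_at_f a : f.[a] = 0 -> @ord_at _ M a (tofrac f) = Some 1.
Proof.
move=> fa; rewrite ord_at_tofrac ?f_neq0 // mup_eq1 ?f_neq0 //; exact/eqP.
Qed.

Let cop1 : coprime d `|1%:Z|%N.
Proof. by rewrite /coprime gcdn1. Qed.

Definition ram_at (a : K) : {poly M} -> option int :=
  ram_place (@ord_at _ M a) (tofrac f) d 1.

Lemma ram_at_above a : f.[a] = 0 -> above (ram_at a) a 0.
Proof.
move=> fa.
have [h1 h2 h3] := ram_place_axioms (ord_at_pval M a) (@ord_at_None _ M a) d_gt0 (ord_at_f fa) cop1.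
have hC q x : ord_at a q = Some x -> ram_at a q%:P = Some (d%:Z * x).
  exact: (ram_place_polyC (ord_at_pval M a) (@ord_at_None _ M a) d_gt0 (ord_at_f fa)).
split; first split=> //.
- move=> c c0; rewrite (hC _ 0) ?mulr0 //.
  by rewrite ord_at_tofrac ?polyC_eq0 // mupNroot // rootC.
- apply: (ram_place_unif (ord_at_pval M a) (@ord_at_None _ M a) d_gt0 (ord_at_f fa) cop1).
  by apply: (pval_surj (q := tofrac ('X - a%:P)) (ord_at_pval M a)); left; apply: ord_at_XsubC.
- by rewrite (hC _ 1) ?ord_at_XsubC //=; lia.
- rewrite /res !rmorph0 subr0 /ram_at.
  by rewrite (ram_place_X (ord_at_pval M a) (@ord_at_None _ M a) d_gt0 (ord_at_f fa)).
Qed.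

Lemma unr_above a b : b != 0 -> f.[a] = b ^+ d -> above (@unr_place _ M f d a b) a b.
Proof.
move=> b0 fab; split.
- exact: (unr_place_gplace d_gt1 dK b0 fab rad_poly_prime).
- by rewrite (unr_place_x M d_gt1 dK b0 fab).
- exact: (unr_place_y d_gt1 dK b0 fab rad_poly_prime).
Qed.

Lemma above_exists a b : f.[a] = b ^+ d -> exists v, above v a b.
Proof.
have [->|b0 fab] := eqVneq b 0; last by exists (unr_place f d a b); apply: unr_above.
by rewrite expr0n gtn_eqF // => fa; exists (ram_at a); apply: ram_at_above.
Qed.

Lemma place_exists a : exists v b, above v a b.
Proof.
have [b hb] := closed_dth_root f.[a] d_gt0.
by have [v hv] := above_exists (esym hb); exists v, b.
Qed.

Lemma unr_uniq v a b : b != 0 -> above v a b -> forall P, v P = unr_place f d a b P.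
Proof.
move=> b0 hab; have fab := above_eq hab; case: hab => vP h1 h2.
exact: (unr_place_uniq d_gt1 dK b0 fab rad_poly_prime vP h1 h2).
Qed.

(** If $x$ has no pole then neither has $Y$, being integral over $K[x]$. If some $x-a$ vanishes,
    $Y^d-f(a)$ splits over $K$ and one of its linear factors vanishes. Otherwise [v] is trivial on
    $K(x)$, hence nonnegative everywhere, although the inverse modulo [C] of an element of value 1
    would have value $-1$. *)
Lemma place_classify v : gplace f d v -> at_oo v \/ exists a b, above v a b.
Proof.
move=> vP; have hv := place_pval d_gt0 vP; have hc := place_const vP.
have X0 : tofrac 'X != 0 by rewrite fm_eq0 polyX_eq0.
have [z hz] := place_polyC d_gt0 vP X0.
have [z0|z0] := ltP z 0; [by left; exists z | right].
have hx : oi_ge (v (inj_poly 'X)) 0 by rewrite /inj_poly /= hz.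
have hpoly u : oi_ge (v (inj_poly u)) 0.
  elim/poly_ind: u => [|u c IH]; first by rewrite rmorph0 (pval0 hv).
  rewrite rmorphD rmorphM; apply: (pval_geD hv); last exact: const_ge0.
  by rewrite -[0]addr0; apply: (pval_geM hv).
have hXd : v 'X^d = v (inj_poly f).
  by have := place_Xd vP 1; rewrite !mul1r.
have hy : oi_ge (v 'X) 0.
  have := hpoly f; rewrite -hXd; case E: (v 'X) => [y|] //.
  rewrite (pvalX hv d E) /= => h; rewrite leNgt; apply/negP => y0.
  have : y * d%:Z <= y by rewrite ger_pMr //; lia.
  by lia.
have [[a ha]|hno] := excluded_middle_informative (exists a, oi_ge (v (inj_poly ('X - a%:P))) 1).
  have rx := place_fin_res ha.
  have rf := res_poly hv hc f rx.
  have [rs E] := closed_field_poly_normal ('X^d - f.[a]%:P : {poly K}).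
  have lp : lead_coef ('X^d - f.[a]%:P : {poly K}) = 1. by rewrite lead_coefXnsubC.
  rewrite lp scale1r in E.
  have E2 : 'X^d - inj_poly f.[a]%:P = \prod_(z <- rs) ('X - inj_poly z%:P).
    have := congr1 (map_poly (tofrac \o polyC)) E.
    rewrite rmorph_prod rmorphB rmorphXn /= map_polyX map_polyC /= => ->.
    by apply: eq_bigr => t _; rewrite rmorphB /= map_polyX map_polyC.
  have hp : oi_ge (v (\prod_(z <- rs) ('X - inj_poly z%:P))) 1.
    rewrite -E2 rad_polyE addrAC (place_modD d_gt0 vP) ?dvdpp //.
  have [b hb] : exists b, oi_ge (v ('X - inj_poly b%:P)) 1.
    move: hp; elim: rs {E E2} => [|b rs IH]; first by rewrite big_nil (pval1 hv).
    rewrite big_cons => h.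
    case E: (v ('X - inj_poly b%:P)) => [x|]; last by exists b; rewrite E.
    have [x0|x0] := ltP 0 x; first by exists b; rewrite E /= -gtz0_ge1.
    apply: IH; move: h; rewrite (pvalM hv) E; case: (v _) => //= y; lia.
  by exists a, b.
have hX a : v (inj_poly ('X - a%:P)) = Some 0.
  have ha : tofrac ('X - a%:P) != 0 by rewrite fm_eq0 polyXsubC_eq0.
  have [x Ex] := place_polyC d_gt0 vP ha.
  have := hpoly ('X - a%:P); rewrite /inj_poly /= Ex /= => x0.
  congr Some; apply/eqP; rewrite eq_le x0 andbT leNgt; apply/negP => x1.
  by apply: hno; exists a; rewrite /inj_poly /= Ex /=; lia.
have hu u : u != 0 -> v (inj_poly u) = Some 0.
  move=> u0; have [rs ->] := closed_field_poly_normal u.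
  rewrite -mul_polyC rmorphM -[0]addr0. apply: (pvalMs hv).
    by apply: hc; rewrite lead_coef_eq0.
  elim: rs => [|a rs IH]; first by rewrite big_nil rmorph1 (pval1 hv).
  rewrite big_cons rmorphM /= -[0]addr0; apply: (pvalMs hv) => //; exact: hX.
have hq q : oi_ge (v q%:P) 0.
  have [u [u' [hu' ->]]] := fractionE q.
  have [->|u0] := eqVneq u 0; first by rewrite rmorph0 mul0r (pval0 hv).
  rewrite polyCM (pvalM hv) [v (tofrac u)%:P](hu u) //.
  have hw := pval_comp (polyC : {rmorphism FX -> {poly FX}}) hv.
  by have /= -> := pval_inv hw (hu u' hu').
have hP P : oi_ge (v P) 0.
  rewrite -[P]coefK poly_def; apply: (pval_ge_sum hv) => i _.
  by rewrite -mul_polyC; have := pval_geM hv (hq P`_i) (pval_geX hv i hy); rewrite addr0.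
have [t ht] : exists t, v t = Some 1 by case: vP.
have : ~~ (C %| t) by apply/negP => /(place_None vP); rewrite ht.
move=> /(rad_poly_coprime d_gt1 rad_poly_prime) /Bezout_eq1_coprimepP[[u1 u2] /= E].
have : v (u1 * t) = Some 0.
  rewrite -(pval1 hv) -E; symmetry; apply: (place_modD d_gt0 vP).
  by rewrite dvdp_mull.
by rewrite (pvalM hv) ht; have := hP u1; case: (v u1) => //= x x0 [h]; lia.
Qed.

(** In other words $K[x][y]$ is integrally closed. Poles of the coefficients are excluded at each
    [a] separately: at a root of $f$ the totally ramified place bounds each coefficient on its own,
    $d\,x+i\ge 0$ with $i<d$ forcing $x\ge 0$; elsewhere the $d$ distinct points of the fibre are
    used. *)
Lemma integral_coef P i : (forall v a b, above v a b -> oi_ge (v P) 0) ->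
  exists u, (P %% C)`_i = tofrac u.
Proof.
move=> hP; set S := P %% C.
have sS : (size S <= d)%N.
  have := ltn_modp P C; rewrite -size_poly_gt0 (size_rad_poly _ _ d_gt0) /= ltnS.
  by move=> ->.
have hS v : gplace f d v -> v S = v P.
  move=> vP; symmetry; apply: (place_eqmod d_gt0 vP).
  by apply/modp_eq0P; rewrite modpD modpN modp_id subrr.
apply: ord_at_regular_poly; first by move=> p /closed_rootP.
move=> a; have hw := ord_at_pval M a.
have [fa|fa] := eqVneq f.[a] 0.
  have hr := ram_at_above fa.
  have := ram_place_coef hw (@ord_at_None _ M a) d_gt0 (ord_at_f fa) cop1 i (hP _ _ _ hr).
  rewrite -/C -/S /wval; case E: (ord_at a S`_i) => [x|] //=.
  have ld : (i < d)%N.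
    rewrite ltnNge; apply/negP => h; move: E; rewrite nth_default ?(leq_trans sS) //.
    by rewrite (pval0 hw).
  move=> h; rewrite leNgt; apply/negP => x0.
  have : d%:Z * x <= d%:Z * (-1) by rewrite ler_pM2l; lia.
  by lia.
have [rs [urs srs hrs]] := radical_roots d_gt0 dK fa.
set t := tofrac ('X - a%:P).
(* If a coefficient had a pole, clearing it and reducing at a would give a nonzero
   polynomial of degree < d vanishing at the d points of the fibre. *)
have step (mu : nat) : (forall j, oi_ge (ord_at a S`_j) (- mu.+1%:Z)) ->
    (forall j, oi_ge (ord_at a S`_j) (- mu%:Z)).
  move=> hmu; set S' := t ^+ mu.+1 *: S.
  have ht : ord_at a (t ^+ mu.+1) = Some mu.+1%:Z.
    by rewrite (pvalX hw _ (ord_at_XsubC M a)) mul1r.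
  have hS' j : oi_ge (ord_at a S'`_j) 0.
    rewrite coefZ -(subrr mu.+1%:Z); apply: (pval_geM hw); last exact: hmu.
    by rewrite ht /=.
  have hcj j : exists c : K, oi_ge (ord_at a (S'`_j - tofrac c%:P)) 1.
    exact: ord_at_regular_residue.
  pose c j := proj1_sig (constructive_indefinite_description _ (hcj j)).
  have hcE j : oi_ge (ord_at a (S'`_j - tofrac (c j)%:P)) 1.
    by rewrite /c; case: constructive_indefinite_description.
  pose pb := \poly_(j < d) c j.
  have pb0 : pb = 0.
    apply/eqP; apply: contraT => pbn0.
    have : (size rs < size pb)%N.
      apply: max_poly_roots => //; apply/allP => b /hrs hb.
      have b0 : b != 0 by apply: contraNneq fa => b0; rewrite -hb b0 expr0n gtn_eqF.
      have hab := unr_above b0 (esym hb); set v := unr_place f d a b in hab.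
      have vP : gplace f d v by case: hab.
      have hv := place_pval d_gt0 vP; have hc := place_const vP.
      have vC q x : ord_at a q = Some x -> v q%:P = Some x by exact: unr_place_polyC.
      have vCge q z : oi_ge (ord_at a q) z -> oi_ge (v q%:P) z.
        case E: (ord_at a q) => [x|]; first by rewrite (vC _ _ E).
        by move/ord_at_None: E => ->; rewrite (pval0 hv).
      have h1 : oi_ge (v S') 1.
        rewrite /S' -mul_polyC -[1]addr0; apply: (pval_geM hv).
          by rewrite (vC _ _ ht) /=; lia.
        by rewrite hS //; apply: hP hab.
      have h2 : res v (\sum_(j < d) inj_poly (c j)%:P * 'X^j) pb.[b].
        rewrite horner_poly; apply: (res_sum hv) => j _.
        apply: (resM hv hc); first exact: res_const.
        by apply: (resX hv hc); apply: above_y hab.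
      have h3 : res v (\sum_(j < d) inj_poly (c j)%:P * 'X^j) 0.
        rewrite -res_pos //.
        have -> : \sum_(j < d) inj_poly (c j)%:P * 'X^j =
            S' - \sum_(j < d) (S'`_j - tofrac (c j)%:P)%:P * 'X^j.
          have sS' : (size S' <= d)%N by apply: leq_trans (size_scale_leq _ _) sS.
          have E : S' = \sum_(j < d) S'`_j *: 'X^j.
            by rewrite -poly_def -[in LHS](take_poly_id sS').
          rewrite {1}E -sumrB; apply: eq_bigr => j _.
          by rewrite -mul_polyC polyCB mulrBl opprB [RHS]addrC subrK.
        apply: (pval_geB hv h1); apply: (pval_ge_sum hv) => j _.
        rewrite -[1]addr0; apply: (pval_geM hv); first exact/vCge/hcE.
        by apply: (pval_geX hv); apply: (res_ge0 hv hc); apply: above_y hab.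
      by rewrite rootE (res_uniq hv hc h2 h3).
    by rewrite srs ltnNge size_poly.
  move=> j; have [ld|ld] := ltnP j d; last first.
    by rewrite nth_default ?(leq_trans sS) // (pval0 hw).
  have cj : c j = 0.
    by have := congr1 (fun p : {poly K} => p`_j) pb0; rewrite coef_poly ld coef0.
  have := hcE j; rewrite cj !rmorph0 subr0 coefZ (pvalM hw) ht.
  by case: (ord_at a S`_j) => //= x; lia.
have [mu hmu] : exists mu : nat, forall j, oi_ge (ord_at a S`_j) (- mu%:Z).
  exists (\max_(j < d) (if ord_at a S`_j is Some x then `|x|%N else 0%N))%N => j.
  have [ld|ld] := ltnP j d; last first.
    by rewrite nth_default ?(leq_trans sS) // (pval0 hw).
  have := leq_bigmax (F := fun j : 'I_d => if ord_at a S`_j is Some x then `|x|%N else 0%N) (Ordinal ld).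
  by move=> /=; case: (ord_at a S`_j) => //= x; lia.
elim: mu hmu => [|mu IH] hmu; first by have := hmu i; rewrite oppr0.
by apply: IH; apply: step.
Qed.

(** * Functions with divisor $k(Q)-k(O)$ *)

Definition has_div (h : {poly M}) (Q : {poly M} -> option int) (k : nat) : Prop :=
  ~~ (C %| h) /\ forall v, gplace f d v ->
    v h = Some (k%:Z * indic (forall P, v P = Q P) - k%:Z * indic (at_oo v)).

Lemma has_div_mod h h' Q k : C %| h - h' -> has_div h Q k -> has_div h' Q k.
Proof.
move=> hh [h1 h2]; split.
  by apply: contra h1 => h1; rewrite -[h](subrK h') dvdp_add.
by move=> v vP; rewrite -(place_eqmod d_gt0 vP hh) h2.
Qed.

Section DivisorSupport.
Variables (Q : {poly M} -> option int) (h : {poly M}) (k : nat).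
Hypothesis QP : gplace f d Q.
Hypothesis Qfin : ~ at_oo Q.
Hypothesis hdiv : has_div h Q k.

Lemma has_div_oo : place_oo h = Some (- k%:Z).
Proof.
have [_ /(_ _ place_oo_gplace) ->] := hdiv.
rewrite (indicT place_oo_at_oo) indicF ?mulr0 ?sub0r ?mulr1 //.
by move=> E; apply: Qfin; case: place_oo_at_oo => z; rewrite E; exists z.
Qed.

Lemma has_div_at : Q h = Some k%:Z.
Proof.
have [_ /(_ Q QP) ->] := hdiv.
by rewrite (indicF Qfin) indicT // mulr0 subr0 mulr1.
Qed.

Lemma has_div_ge0 v a b : above v a b -> oi_ge (v h) 0.
Proof.
move=> hab; have vP : gplace f d v by case: hab.
have [_ /(_ v vP) ->] := hdiv.
rewrite (indicF (above_fin hab)) mulr0 subr0.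
have [E|E] := excluded_middle_informative (forall P, v P = Q P).
  by rewrite indicT // mulr1.
by rewrite indicF // mulr0.
Qed.

Lemma has_div_pos v a b : above v a b -> oi_ge (v h) 1 -> forall P, v P = Q P.
Proof.
move=> hab; have vP : gplace f d v by case: hab.
have [_ /(_ v vP) ->] := hdiv.
rewrite (indicF (above_fin hab)) mulr0 subr0.
have [//|E] := excluded_middle_informative (forall P, v P = Q P).
by rewrite indicF // mulr0.
Qed.

Lemma has_div_root v a b a0 b0 : above Q a0 b0 -> above v a b -> res v h 0 -> a = a0.
Proof.
move=> hQ hab; have vP : gplace f d v by case: hab.
rewrite -res_pos => /(has_div_pos hab) E.
have hQ' : above v a0 b0 by case: hQ => h1 h2 h3; split; rewrite // /res E.
by have [] := above_uniq hab hQ'.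
Qed.

Lemma two_term : (d < n)%N -> (k < n + d)%N -> exists s c,
  [/\ has_div (inj_poly s + inj_poly c%:P * 'X) Q k, (d * (size s).-1 <= k)%N
    & c != 0 -> (n <= k)%N].
Proof.
move=> dn kn.
have [u hu] : exists u : nat -> {poly K}, forall i, (h %% C)`_i = tofrac (u i).
  have hi i := integral_coef i has_div_ge0.
  exists (fun i => proj1_sig (constructive_indefinite_description _ (hi i))) => i.
  by case: constructive_indefinite_description.
have hk i : u i != 0 -> (d * (size (u i)).-1 + n * i <= k)%N.
  move=> ui; have := @place_oo_coef h (- k%:Z) i; rewrite has_div_oo /= => /(_ (lexx _)).
  rewrite hu ord_oo_tofrac //= => hle.
  rewrite -lez_nat PoszD !PoszM -lerN2 opprD -mulrN -mulNr. exact: hle.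
(* A term of degree $i\ge 2$ in $y$ has pole order at least $2n>n+d>k$. For $i=1$, the bound $d\deg
   u_1+n\le k<n+d$ leaves only a constant. *)
have u2 i : (2 <= i)%N -> u i = 0.
  move=> i2; apply/eqP; apply: contraT => /hk /(leq_trans (leq_addl _ _)) h1.
  by have := leq_trans (leq_mul (leqnn n) i2) h1; lia.
have su1 : (size (u 1%N) <= 1)%N.
  have [->|/hk] := eqVneq (u 1%N) 0; first by rewrite size_poly0.
  case: (size (u 1%N)) => [|[|x]] //= hx; exfalso.
  by have : (d * 1 <= d * x.+1)%N; rewrite ?leq_mul //; lia.
exists (u 0%N), (u 1%N)`_0; rewrite -size1_polyC //; split.
- apply: has_div_mod hdiv; have -> : inj_poly (u 0%N) + inj_poly (u 1%N) * 'X = h %% C.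
    apply/polyP => i; rewrite hu coefD coefC coefMX coefC.
    case: i => [|[|i]] /=; rewrite ?addr0 ?add0r //.
    by rewrite u2 // rmorph0.
  by apply/modp_eq0P; rewrite modpD modpN modp_id subrr.
- by have [->|/hk] := eqVneq (u 0%N) 0; [rewrite size_poly0 muln0 | move/(leq_trans (leq_addr _ _))].
- move=> c0; have /hk : u 1%N != 0 by apply: contraNneq c0 => ->; rewrite coef0.
  by move/(leq_trans (leq_addl _ _)); rewrite muln1.
Qed.

End DivisorSupport.

Lemma res_two_term v a b s c : above v a b ->
  res v (inj_poly s + inj_poly c%:P * 'X) (s.[a] + c * b).
Proof.
move=> hab; have vP : gplace f d v by case: hab.
have hv := place_pval d_gt0 vP; have hc := place_const vP.
apply: (resD hv); first exact: above_poly hab s.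
by apply: (resM hv hc); [apply: res_const | apply: above_y hab].
Qed.

(** A root $a$ of the norm gives $b=-s(a)/c$ with $b^d=f(a)$, so $(a,b)$ is a point of the curve at
    which $s+cy$ vanishes. The only such point is $Q$, whence $a=a_0$. *)
Lemma norm_pow Q a0 b0 s c k : above Q a0 b0 ->
  has_div (inj_poly s + inj_poly c%:P * 'X) Q k -> c != 0 ->
  let N := s ^+ d - (- c) ^+ d *: f in
  N = lead_coef N *: ('X - a0%:P) ^+ (size N).-1.
Proof.
move=> hQ hdiv c0 N; apply: root_unique_pow => a.
rewrite rootE /N !hornerE subr_eq0 => /eqP E.
have hb : f.[a] = (s.[a] / - c) ^+ d.
  by rewrite expr_div_n E mulrAC divff ?mul1r // expf_neq0 // oppr_eq0.
have [v hv] := above_exists hb.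
apply: (has_div_root hdiv hQ hv).
have := res_two_term s c hv.
by rewrite invrN !mulrN mulrCA divff // mulr1 subrr.
Qed.

(** If $Q$ were $O$, the constant 1 would have divisor $(Q)-(O)$ and the order would be 1. *)
Lemma not_at_oo Q m : gplace f d Q -> (1 < m)%N ->
  (forall k, (0 < k < m)%N -> ~ exists h, has_div h Q k) -> ~ at_oo Q.
Proof.
move=> QP m1 hm Qoo; apply: (hm 1%N) => //; exists 1; split.
  by apply: rad_poly_ndvd_small; rewrite ?oner_neq0 // size_poly1.
move=> v vP; rewrite (pval1 (place_pval d_gt0 vP)).
have [E|E] := excluded_middle_informative (at_oo v).
  by rewrite !indicT ?subrr // => P; rewrite (at_oo_uniq vP E) (at_oo_uniq QP Qoo).
rewrite !indicF // => E'; apply: E; case: Qoo => z; rewrite -E'; by exists z.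
Qed.

Lemma torsion_degree_bound Q k0 m : gplace f d Q -> (d < n)%N -> m = (d * k0)%N ->
  (n < m)%N -> (m < n + d)%N -> (exists h, has_div h Q m) ->
  (forall k, (0 < k < m)%N -> ~ exists h, has_div h Q k) -> (d.-1 * k0 <= n)%N.
Proof.
move=> QP dn mE nm mn [h hdiv] hmin.
have Qfin := not_at_oo QP (leq_ltn_trans (ltnW (ltn_trans d_gt1 dn)) nm) hmin.
have [//|[a0 [b0 hQ]]] := place_classify QP.
have [s [c [hsc ds _]]] := two_term Qfin hdiv dn mn.
have k0_gt0 : (0 < k0)%N by case: (k0) mE => // E; rewrite E muln0 in nm.
have hoo := has_div_oo Qfin hsc.
have poo := place_pval d_gt0 place_oo_gplace.
have sz : (size s).-1 = k0.
  (* With a smaller degree, $s$ has a pole of order below $m$ at infinity, and so has $cy$ because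
     $n<m$; their sum could not have pole order $m$. *)
  apply/eqP; rewrite eqn_leq -(leq_pmul2l d_gt0) -mE ds /= leqNgt; apply/negP => lt.
  have hlt : (d * (size s).-1 < m)%N by rewrite mE ltn_pmul2l.
  have : oi_ge (place_oo (inj_poly s + inj_poly c%:P * 'X)) (- m%:Z + 1).
    apply: (pval_geD poo).
      have [->|s0] := eqVneq s 0; first by rewrite rmorph0 (pval0 poo).
      by rewrite place_oo_poly //=; move: hlt; move: (d * _)%N => x; lia.
    have [->|c0] := eqVneq c 0; first by rewrite !rmorph0 mul0r (pval0 poo).
    have h1 := place_oo_poly (u := c%:P); rewrite polyC_eq0 c0 size_polyC c0 muln0 in h1.
    by rewrite (pvalMs poo (h1 isT) place_ooX) /=; lia.
  by rewrite hoo /=; lia.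
have s0 : s != 0 by apply: contraTneq k0_gt0 => s0; rewrite -sz s0 size_poly0.
have szs : size s = k0.+1 by rewrite -sz prednK // size_poly_gt0.
have [c0|c0] := eqVneq c 0.
  rewrite c0 !rmorph0 mul0r addr0 in hsc.
  have sE : s = lead_coef s *: ('X - a0%:P) ^+ k0.
    rewrite -sz; apply: root_unique_pow => a /rootP sa.
    have [v [b hv]] := place_exists a.
    by apply: (has_div_root hsc hQ hv); rewrite -sa; apply: above_poly hv s.
  exfalso; apply: (hmin d); first by apply/andP; split=> //; lia.
  exists (inj_poly ('X - a0%:P)); split.
    apply: rad_poly_ndvd_small => //; last by rewrite (leq_trans (size_polyC_leq1 _)).
    by rewrite polyC_eq0 fm_eq0 polyXsubC_eq0.
  (* At every place the value of $s$ is $k_0$ times that of $x-a_0$, so the divisor of $x-a_0$ is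
     obtained by dividing by $k_0$, with no knowledge of the places over $a_0$. *)
  move=> v vP; have hv := place_pval d_gt0 vP.
  have X0 : tofrac ('X - a0%:P) != 0 by rewrite fm_eq0 polyXsubC_eq0.
  have [x Ex] := place_polyC d_gt0 vP X0.
  have El := place_const vP (c := lead_coef s); rewrite lead_coef_eq0 s0 in El.
  case: hsc => _ /(_ v vP); rewrite {1}sE -mul_polyC rmorphM rmorphXn.
  rewrite (pvalMs hv (El isT) (pvalX hv k0 Ex)) add0r => -[E].
  have k0z : k0%:Z != 0 by lia.
  rewrite {1}/inj_poly /= Ex; congr Some; apply: (mulIf k0z); rewrite E mE PoszM; ring.
have N := norm_pow hQ hsc c0.
have sN1 : size (s ^+ d) = m.+1.
  have := size_exp s d; rewrite szs /= mulnC -mE => <-.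
  by rewrite prednK // size_poly_gt0 expf_neq0.
have sN2 : (size (- ((- c) ^+ d *: f)) < size (s ^+ d))%N.
  by rewrite size_polyN (leq_ltn_trans (size_scale_leq _ _)) // size_f sN1.
rewrite /= size_polyDl // sN1 lead_coefDl // lead_coef_exp /= mE in N.
pose e := lead_coef s; pose W := e *: ('X - a0%:P) ^+ k0.
have e0 : e != 0 by rewrite lead_coef_eq0.
have fE : (- c) ^+ d *: f = s ^+ d - W ^+ d.
  by rewrite /W exprZn -exprM mulnC -N opprB addrC subrK.
have sW : size W = k0.+1.
  by rewrite size_scale // size_exp_XsubC.
have lW : lead_coef W = e.
  by rewrite lead_coefZ lead_coef_exp lead_coefXsubC expr1n mulr1.
have g0 : d%:R * e ^+ d.-1 != 0 by rewrite mulf_neq0 ?expf_neq0.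
have [sS _] := geom_lead d_gt0 szs sW (erefl _) lW g0.
have cd0 : (- c) ^+ d != 0 by rewrite expf_neq0 // oppr_eq0.
have := congr1 (fun p : {poly K} => size p) fE; rewrite /= size_scale // size_f subrXX.
set S := \sum_(i < d) _ in sS * => E.
have S0 : S != 0 by rewrite -size_poly_gt0 sS.
(* Since $f\ne 0$ the factor $s-W$ is nonzero, so the degree of its cofactor $S$ is at most $n$. *)
have r0 : s - W != 0 by apply: contra_eq_neq E => ->; rewrite mul0r size_poly0.
move: E; rewrite size_mul // sS; move: r0; rewrite -size_poly_gt0.
move: (size (s - W)) (d.-1 * k0)%N => x y; lia.
Qed.

(** * Points of exact order $m$ *)

Lemma has_div_sub Q h h' m k : (k <= m)%N -> has_div h Q m -> has_div h' Q k ->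
  exists g, has_div g Q (m - k).
Proof.
move=> km [h1 h2] [h1' h2'].
(* The inverse of $h'$ in the function field is represented by a Bezout coefficient modulo [C]. *)
have /Bezout_eq1_coprimepP[[u1 u2] /= E] := rad_poly_coprime d_gt1 rad_poly_prime h1'.
have hu v : gplace f d v -> oi_add (v u1) (v h') = Some 0.
  move=> vP; have hv := place_pval d_gt0 vP; rewrite -(pvalM hv) -(pval1 hv) -E.
  by symmetry; apply: (place_modD d_gt0 vP); rewrite dvdp_mull.
exists (h * u1); split.
  apply/negP => /rad_poly_prime /orP[|hd]; first by apply/negP.
  have := hu _ place_oo_gplace.
  by have /(place_None place_oo_gplace)-> := hd.
move=> v vP; rewrite (pvalM (place_pval d_gt0 vP)) (h2 v vP).
have := hu v vP; rewrite (h2' v vP); case: (v u1) => //= x [Ex].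
rewrite -subzn //; congr Some; move: Ex.
move: (indic _) (indic _) => j i Ex.
have -> : x = - (k%:Z * i - k%:Z * j) by apply/eqP; rewrite -addr_eq0 Ex.
ring.
Qed.

(** On the curve $s^d-t^dy^d=x^m$ factors as $h\,G$ with $h=s-ty$. Where $x\ne 0$ both factors are
    regular, so both are units. Over $x=0$ the function $h$ vanishes only at $y=b=s(0)/t(0)$; there
    $G$ has residue $d\,s(0)^{d-1}\ne 0$, so $h$ takes the whole multiplicity $m$. The degree
    condition makes $s$ dominate $ty$ at infinity. *)
Lemma torsion_from_norm s t m : (0 < m)%N -> s ^+ d - t ^+ d * f = 'X^m ->
  s.[0] != 0 -> (d * (size t).-1 + n < m)%N ->
  exists Q b, [/\ above Q 0 b, b != 0 & has_div (inj_poly s - inj_poly t * 'X) Q m].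
Proof.
move=> m0 E s0 dt.
have E0 : s.[0] ^+ d = t.[0] ^+ d * f.[0].
  have := congr1 (fun p : {poly K} => p.[0]) E; rewrite !hornerE.
  by rewrite expr0n gtn_eqF // => /eqP; rewrite subr_eq0 => /eqP.
have t0 : t.[0] != 0.
  apply: contraNneq s0 => t0; move/eqP: E0; rewrite t0 expr0n gtn_eqF // mul0r.
  by rewrite expf_eq0 => /andP[].
pose b := s.[0] / t.[0].
have b0 : b != 0 by rewrite mulf_neq0 // invr_eq0.
have fb : f.[0] = b ^+ d by rewrite expr_div_n E0 mulrAC divff ?mul1r // expf_neq0.
have sE : s.[0] = t.[0] * b by rewrite mulrC divfK.
have hQ := unr_above b0 fb; set Q := unr_place f d 0 b in hQ.
exists Q, b; split=> //; set h := inj_poly s - inj_poly t * 'X.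
have tn0 : t != 0 by apply: contraNneq t0 => ->; rewrite horner0.
have sn0 : s != 0 by apply: contraNneq s0 => ->; rewrite horner0.
have QP : gplace f d Q by case: hQ.
have Qfin := above_fin hQ.
split.
  apply: rad_poly_ndvd_small => //.
    apply: contraNneq tn0 => h0; have := congr1 (fun p : {poly FX} => p`_1) h0.
    rewrite coefB coefMX !coefC ?coef0 /= sub0r => /eqP.
    by rewrite oppr_eq0 fm_eq0.
  rewrite (leq_trans (size_polyD _ _)) // size_polyN geq_max.
  rewrite (leq_trans (size_polyC_leq1 _)) ?(ltnW d_gt1) //=.
  rewrite (leq_trans (size_polyMleq _ _)) // size_polyX addn2 /=.
  by rewrite (leq_trans _ d_gt1) // ltnS size_polyC_leq1.
move=> v vP; have hv := place_pval d_gt0 vP; have hc := place_const vP.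
have [voo|[a [b' hab]]] := place_classify vP.
  rewrite (indicT voo) indicF; last first.
    by move=> EQ; apply: Qfin; case: voo => z; rewrite EQ; exists z.
  rewrite mulr0 mulr1 sub0r (at_oo_uniq vP voo).
  have poo := place_pval d_gt0 place_oo_gplace.
  have szs : (d * (size s).-1)%N = m.
    have /eqP : s ^+ d = 'X^m + t ^+ d * f by rewrite -E subrK.
    have lt : (size (t ^+ d * f)%R < size ('X^m : {poly K})%R)%N.
      rewrite size_polyXn ltnS size_mul ?expf_neq0 ?f_neq0 // size_f addnS /=.
      have := size_exp t d; have : (0 < size (t ^+ d)%R)%N by rewrite size_poly_gt0 expf_neq0.
      move: dt; rewrite [(d * _)%N]mulnC.
      by move: (size (t ^+ d)) ((size t).-1 * d)%N => x y; lia.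
    move=> /eqP /(congr1 (fun p : {poly K} => (size p).-1)).
    by rewrite /= size_polyDl // size_polyXn size_exp mulnC.
  apply: (pvalD_dom poo); first by rewrite place_oo_poly // szs.
  rewrite (pvalN poo) (pvalMs poo (place_oo_poly tn0) place_ooX) /=.
  by move: dt; move: (d * _)%N => x; lia.
rewrite (indicF (above_fin hab)) mulr0 subr0.
have rh : res v h (s.[a] - t.[a] * b').
  apply: (resB hv); first exact: above_poly hab s.
  by apply: (resM hv hc); [exact: above_poly hab t | exact: above_y hab].
pose G := \sum_(i < d) inj_poly s ^+ (d.-1 - i) * (inj_poly t * 'X) ^+ i.
have hG : oi_add (v h) (v G) = v (inj_poly 'X ^+ m).
  rewrite -(pvalM hv) -subrXX exprMn -!rmorphXn -E.
  rewrite rmorphB rmorphM; apply: (place_eqmod d_gt0 vP).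
  have Er (x y z : {poly FX}) : x - (y + z) - (x - y) = - z by ring.
  by rewrite rad_polyE mulrDr Er -mulNr dvdp_mull.
have rG : oi_ge (v G) 0.
  apply: (pval_ge_sum hv) => i _; rewrite -[0]addr0; apply: (pval_geM hv).
    by apply: (pval_geX hv); apply: (res_ge0 hv hc); apply: above_poly hab s.
  apply: (pval_geX hv); rewrite -[0]addr0; apply: (pval_geM hv).
    by apply: (res_ge0 hv hc); apply: above_poly hab t.
  by apply: (res_ge0 hv hc); apply: above_y hab.
have notQ : (a != 0) || (b' != b) -> ~ (forall P, v P = Q P).
  move=> hne EQ; have hQ' : above v 0 b by case: hQ => h1 h2 h3; split; rewrite // /res EQ.
  by have [ea eb] := above_uniq hab hQ'; rewrite ea eb !eqxx in hne.
have [a0|a0] := eqVneq a 0; last first.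
  rewrite (indicF (notQ _)) ?a0 // mulr0.
  have vX : v (inj_poly 'X) = Some 0 by apply: (res_unit hv hc (above_x hab)).
  move: hG; rewrite (pvalX hv m vX) mul0r; have := res_ge0 hv hc rh.
  by case: (v h) rG => [x|] //; case: (v G) => [y|] //= y0 x0 [xy]; congr Some; lia.
rewrite a0 in hab rh.
have [eb|nb] := eqVneq b' b; last first.
  rewrite (indicF (notQ _)) ?nb ?orbT // mulr0.
  by apply: (res_unit hv hc rh); rewrite sE -mulrBr mulf_neq0 // subr_eq0 eq_sym.
rewrite eb in hab; have EQ := unr_uniq b0 hab.
rewrite indicT // mulr1.
have vG : v G = Some 0.
  apply: (res_unit hv hc (c := d%:R * s.[0] ^+ d.-1)); last by rewrite mulf_neq0 ?expf_neq0.
  apply: (res_geom hv hc d (above_poly hab s)); rewrite sE.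
  by apply: (resM hv hc); [exact: above_poly hab t | exact: above_y hab].
have vX : v (inj_poly 'X) = Some 1.
  by rewrite EQ; have := unr_place_x M d_gt1 dK b0 fb; rewrite rmorph0 subr0.
move: hG; rewrite vG (pvalX hv m vX) mul1r.
by case: (v h) => //= x; rewrite addr0.
Qed.

Lemma small_order Q b h k : above Q 0 b -> b != 0 -> (d < n)%N -> (0 < k <= n)%N ->
  has_div h Q k -> k = n /\ exists (s : {poly K}) (c c' : K),
    [/\ c != 0, (d * (size s).-1 <= n)%N & s ^+ d - c *: f = c' *: 'X^n].
Proof.
move=> hQ b0 dn /andP[k0 kn] hdiv.
have QP : gplace f d Q by case: hQ.
have Qfin := above_fin hQ.
have kd : (k < n + d)%N by lia.
have [s [c [hsc ds hc]]] := two_term Qfin hdiv dn kd.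
have [c0|c0] := eqVneq c 0.
  rewrite c0 !rmorph0 mul0r addr0 in hsc; exfalso.
  have hv := place_pval d_gt0 QP; have hcc := place_const QP.
  have s0 : s.[0] = 0.
    apply/eqP; apply: contraT => s0.
    have := has_div_at QP Qfin hsc; rewrite (res_unit hv hcc (above_poly hQ s) s0) => -[]; lia.
  have bd0 : b ^+ d != 0 by rewrite expf_neq0.
  have [rs [urs srs hrs]] := radical_roots d_gt0 dK bd0.
  have [b' hb' nb] : exists2 b', b' ^+ d = b ^+ d & b' != b.
    have : (1 < size rs)%N by rewrite srs.
    case: rs urs srs hrs => [|x [|y rs]] // urs srs hrs _.
    have [xb|xb] := eqVneq x b.
      exists y; first by apply: hrs; rewrite !inE eqxx orbT.
      by move: urs; rewrite /= inE negb_or -xb eq_sym => /andP[/andP[]].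
    by exists x => //; apply: hrs; rewrite inE eqxx.
  have fb' : f.[0] = b' ^+ d by rewrite hb' (above_eq hQ).
  have [v hab] := above_exists fb'.
  have vP : gplace f d v by case: hab.
  have rv := above_poly hab s; rewrite s0 -res_pos in rv.
  have EQ := has_div_pos hsc hab rv.
  have hQ' : above v 0 b by case: hQ => h1 h2 h3; split; rewrite // /res EQ.
  by have [_ eb] := above_uniq hab hQ'; rewrite eb eqxx in nb.
have kE : k = n by apply/eqP; rewrite eqn_leq kn hc.
split=> //; exists s, ((- c) ^+ d).
have N := norm_pow hQ hsc c0; set p := _ - _ in N *.
(* Equality would make $d$ divide $n$. With strict inequality the norm has the degree of $f$, which
   fixes the exponent $n$ of $x$. *)
have ds' : (d * (size s).-1 < n)%N.
  rewrite ltn_neqAle -kE ds andbT kE; apply/negP => /eqP E.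
  have : (d %| gcdn n d)%N by rewrite dvdn_gcd dvdnn -E dvdn_mulr.
  by rewrite (eqP cop) dvdn1 => /eqP d1; move: d_gt1; rewrite d1.
have cd0 : (- c) ^+ d != 0 by rewrite expf_neq0 // oppr_eq0.
have sp : size p = n.+1.
  rewrite /p addrC size_polyDl ?size_polyN size_scale ?size_f //.
  have [->|s0] := eqVneq s 0; first by rewrite expr0n gtn_eqF // size_poly0.
  have := size_exp s d; have : (0 < size (s ^+ d)%R)%N by rewrite size_poly_gt0 expf_neq0.
  move: ds'; rewrite mulnC; move: (size (s ^+ d)) ((size s).-1 * d)%N => x y; lia.
exists (lead_coef p); split=> //; first by rewrite -kE.
by rewrite {1}N sp rmorph0 subr0.
Qed.

Lemma point_order_exact s t m : (d < n)%N -> (1 < m)%N -> s ^+ d - t ^+ d * f = 'X^m ->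
  s.[0] != 0 -> (d * (size t).-1 + n < m)%N ->
  (forall k, (2 * k <= m)%N -> (k <= n)%N) ->
  ((2 * n <= m)%N -> forall (u : {poly K}) (c c' : K), c != 0 -> (d * (size u).-1 <= n)%N ->
     u ^+ d - c *: f <> c' *: 'X^n) ->
  exists Q, [/\ gplace f d Q, (0 < m)%N, exists h, has_div h Q m
    & forall k, (0 < k < m)%N -> ~ exists h, has_div h Q k].
Proof.
move=> dn m1 E s0 dt hk hn; have m0 := ltnW m1.
have [Q [b [hQ b0 hdiv]]] := torsion_from_norm m0 E s0 dt.
exists Q; split=> //; [by case: hQ | by eexists; exact: hdiv |].
have half k h : (0 < k)%N -> (2 * k <= m)%N -> ~ has_div h Q k.
  move=> k0 km hd; have kn := hk _ km.
  have k0n : (0 < k <= n)%N by rewrite k0.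
  have [Ek [u [c [c' [c0 du Eu]]]]] := small_order hQ b0 dn k0n hd.
  by apply: (hn _ u c c' c0 du Eu); rewrite -Ek.
move=> k /andP[k0 km] [h hd].
have [le|lt] := leqP (2 * k) m; first exact: (half _ _ k0 le hd).
have [g hg] := has_div_sub (ltnW km) hdiv hd.
by apply: (half _ _ _ _ hg); lia.
Qed.

End CurvePlaces.

(** * Construction of curves *)

Lemma closed_avoid (K : closedFieldType) (rs : seq K) : exists b, b \notin rs.
Proof.
have /closed_nonrootP[b hb] : \prod_(z <- rs) ('X - z%:P) != 0 :> {poly K}.
  by rewrite monic_neq0 // monic_prod_XsubC.
by exists b; rewrite -root_prod_XsubC.
Qed.

Lemma closed_root_seq (K : closedFieldType) (p : {poly K}) :
  p != 0 -> exists rs : seq K, forall a, root p a -> a \in rs.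
Proof.
move=> p0; have [rs E] := closed_field_poly_normal p; exists rs => a.
by rewrite E rootZ ?lead_coef_eq0 // root_prod_XsubC.
Qed.

(** At a double root the values and the derivatives of $s^d$ and $x^{dl}$ agree, so their
    logarithmic derivatives do: $d\,s'/s=dl/a$, and $d$ cancels. *)
Lemma double_root_norm (F : fieldType) (s : {poly F}) (d l : nat) (a : F) :
  (0 < d)%N -> (0 < l)%N -> d%:R != 0 :> F -> s.[0] != 0 ->
  ('X - a%:P) ^+ 2 %| s ^+ d - 'X^(d * l) ->
  [/\ a != 0, s.[a] ^+ d = a ^+ (d * l) & a * s^`().[a] = l%:R * s.[a]].
Proof.
move=> d0 l0 dF s0 /double_root[]; rewrite /root.
rewrite derivB derivXn deriv_exp !hornerE !hornerMn !hornerE !subr_eq0 => /eqP E1 /eqP E2.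
have a0 : a != 0.
  apply: contraNneq s0 => a0; move: E1; rewrite a0 expr0n muln_eq0 !gtn_eqF //= => /eqP.
  by rewrite expf_eq0 => /andP[].
split=> //.
have dl0 : (0 < d * l)%N by rewrite muln_gt0 d0.
have h0 : d%:R * a ^+ (d * l) != 0 by rewrite mulf_neq0 // expf_neq0.
apply: (mulfI h0).
have Ea : a ^+ (d * l) = a * a ^+ (d * l).-1 by rewrite -exprS prednK.
have Es : s.[a] ^+ d = s.[a] * s.[a] ^+ d.-1 by rewrite -exprS prednK.
move: E2; rewrite -(mulr_natr _ d) -(mulr_natr _ (d * l)) natrM => E2.
transitivity (a * s.[a] * (s^`().[a] * s.[a] ^+ d.-1 * d%:R)).
  by rewrite -E1 Es; ring.
by rewrite E2 Ea; ring.
Qed.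

(** * The general family of curves *)

Section GeneralCurve.
Variables (K : closedFieldType) (d l e : nat).
Hypothesis d_gt1 : (1 < d)%N.
Hypothesis l_gt0 : (0 < l)%N.
Hypothesis el : (e < l)%N.
Hypothesis dK : d%:R != 0 :> K.
Hypothesis char0 : e = 0%N -> l%:R != 0 :> K.
Hypothesis charn : (0 < e)%N -> e%:R != 0 :> K.
Let d_gt0 : (0 < d)%N := ltnW d_gt1.

(** The difference factors as $r$ times a geometric sum of degree $(d-1)l$ with leading coefficient
    $d$. *)
Lemma power_difference (r : {poly K}) : (size r <= l)%N -> r != 0 ->
  let F := ('X^l + r) ^+ d - 'X^(d * l) in
  size F = (size r + d.-1 * l)%N /\ lead_coef F = d%:R * lead_coef r.
Proof.
move=> sr r0 F.
have lt : (size r < size ('X^l : {poly K}))%N by rewrite size_polyXn ltnS.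
have sA : size ('X^l + r) = l.+1 by rewrite size_polyDl // size_polyXn.
have lA : lead_coef ('X^l + r) = 1 by rewrite lead_coefDl // lead_coefXn.
have g0 : d%:R * 1 ^+ d.-1 != 0 :> K by rewrite expr1n mulr1.
have [] := geom_lead d_gt0 sA (size_polyXn _ _) lA (lead_coefXn _ _) g0.
set S := \sum_(i < d) _ => sS lS.
have FE : F = r * S by rewrite /F mulnC exprM subrXX addrAC subrr add0r.
have S0 : S != 0 by rewrite -size_poly_gt0 sS.
rewrite FE size_mul // sS addnS /=; split=> //.
by rewrite lead_coefM lS expr1n mulr1 mulrC.
Qed.

Lemma general_remainder : exists r : {poly K},
  [/\ size r = e.+1, lead_coef r = 1, r.[0] != 0
    & forall a, ~~ (('X - a%:P) ^+ 2 %| ('X^l + r) ^+ d - 'X^(d * l))].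
Proof.
have hs (r : {poly K}) : r.[0] != 0 -> ('X^l + r).[0] != 0.
  by move=> r0; rewrite hornerD hornerXn expr0n gtn_eqF // add0r.
have key (r : {poly K}) (a : K) : r.[0] != 0 -> ('X - a%:P) ^+ 2 %| ('X^l + r) ^+ d - 'X^(d * l) ->
    [/\ a != 0, ('X^l + r).[a] ^+ d = a ^+ (d * l) & a * r^`().[a] = l%:R * r.[a]].
  move=> r0 /(double_root_norm d_gt0 l_gt0 dK (hs _ r0))[a0 E1 E2]; split=> //.
  have Ea : a ^+ l = a * a ^+ l.-1 by rewrite -exprS prednK.
  move: E2; rewrite derivD derivXn !hornerE !hornerMn !hornerE -mulr_natl mulrDr mulrDr.
  by rewrite mulrCA -Ea => /addrI.
have [e0|e_gt0] := posnP e.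
  exists 1; rewrite e0 size_poly1 lead_coef1 hornerC oner_neq0; split=> // a.
  apply/negP => /key; rewrite hornerC oner_neq0 => /(_ isT)[_ _].
  rewrite derivC !hornerE => /esym/eqP; by rewrite (negbTE (char0 e0)).
(* For $r=x^e+b$ a double root satisfies $e\,a^e=l(a^e+b)$. If $l\ne 0$ in $K$ then $r(a)=W(a)$, so
   $a$ is a root of [D], which does not involve $b$; each such root excludes one $b$. If $l=0$ in
   $K$ the equation reads $e\,a^e=0$, which is impossible. *)
pose W : {poly K} := (e%:R / l%:R) *: 'X^e.
pose D := ('X^l + W) ^+ d - 'X^(d * l).
have [rs hrs] : exists rs : seq K, l%:R != 0 :> K -> forall a, root D a -> a \in rs.
  have [l0|l0] := eqVneq (l%:R : K) 0; first by exists [::].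
  have W0 : W != 0.
    by rewrite scaler_eq0 negb_or mulf_neq0 ?charn ?invr_eq0 // -size_poly_gt0 size_polyXn.
  have sW : (size W <= l)%N by rewrite (leq_trans (size_scale_leq _ _)) // size_polyXn.
  have [sD _] := power_difference sW W0.
  have D0 : D != 0 by rewrite -size_poly_gt0 sD ltn_addr // size_poly_gt0.
  by have [rs h] := closed_root_seq D0; exists rs.
have [b hb] := closed_avoid (0 :: [seq (e%:R - l%:R) / l%:R * a ^+ e | a <- rs]).
move: hb; rewrite inE negb_or => /andP[b0 hb].
exists ('X^e + b%:P); rewrite size_XnaddC // lead_coefXnaddC //.
have r0 : ('X^e + b%:P).[0] != 0 by rewrite hornerD hornerXn ?hornerC expr0n gtn_eqF // add0r.
split=> // a; apply/negP => /(key _ _ r0)[a0].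
rewrite derivD derivXn derivC addr0 !hornerE !hornerMn !hornerE => E1.
have Ea : a ^+ e = a * a ^+ e.-1 by rewrite -exprS prednK.
rewrite -mulr_natl mulrCA -Ea mulrDr => E2.
have [l0|l0] := eqVneq (l%:R : K) 0.
  move/eqP: E2; rewrite l0 !mul0r addr0 mulf_eq0 (negbTE (charn e_gt0)) /=.
  by rewrite expf_eq0 (negbTE a0) andbF.
have bE : b = (e%:R - l%:R) / l%:R * a ^+ e.
  by apply: (mulfI l0); rewrite mulrA mulrCA divff // mulr1 mulrBl E2 addrC addKr.
case/negP: hb; apply/mapP; exists a => //; apply: hrs => //.
have Eb : e%:R / l%:R * a ^+ e = a ^+ e + b.
  by rewrite bE mulrBl divff // mulrBl mul1r addrC subrK.
by rewrite rootE /D /W !hornerE subr_eq0 -E1 Eb /= addrA.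
Qed.

Lemma general_curve : exists f s t : {poly K},
  [/\ f \is monic, size f = (e + d.-1 * l).+1, no_repeated_roots f
    & [/\ s ^+ d - t ^+ d * f = 'X^(d * l), s.[0] != 0 & (size t).-1 = 0%N]].
Proof.
have [r [sr lr r0 hr]] := general_remainder.
have rn0 : r != 0 by rewrite -size_poly_gt0 sr.
have srl : (size r <= l)%N by rewrite sr.
have [sF lF] := power_difference srl rn0.
set F := _ - _ in hr sF lF.
rewrite lr mulr1 in lF; rewrite sr addSn in sF.
(* The constant $t=g$ with $g^d=d$ absorbs the leading coefficient $d$ of [F], so that $f$ is
   monic. *)
have [g hg] := closed_dth_root (d%:R : K) d_gt0.
have d1 : (d%:R)^-1 != 0 :> K by rewrite invr_eq0.
exists ((d%:R)^-1 *: F), ('X^l + r), g%:P; split.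
- by apply/monicP; rewrite lead_coefZ lF mulVf.
- by rewrite size_scale.
- by move=> a; rewrite dvdpZr.
- split; last by rewrite size_polyC; case: eqP.
    rewrite -polyC_exp hg mul_polyC scalerA divff // scale1r.
    by rewrite /F opprB addrC subrK.
  by rewrite hornerD hornerXn ?hornerC expr0n gtn_eqF // add0r.
Qed.

End GeneralCurve.

(* For d = 2 and l = n, general_curve gives y^2 = x^n + const, where the point has order
   n only.  Here (x - 1)^2 f is proportional to A (A + 2 x^n) = (A + x^n)^2 - x^(2n),
   with A tangent to - 2 x^n at 1. *)
Section QuadraticCurve.
Variables (K : closedFieldType) (n : nat).
Hypothesis n_gt2 : (2 < n)%N.
Hypothesis K2 : 2%:R != 0 :> K.
Hypothesis Kn : n%:R != 0 :> K.
Let z : {poly K} := 'X - 1.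

(** In $x^n-1=z\sum_{i<n}x^i$ the sum takes the value $n$ at 1, so subtracting $nz$ produces a
    second factor $z$. *)
Lemma tangent_quotient : exists2 g : {poly K},
  'X^n - 1 - n%:R *: z = z ^+ 2 * g & size g = n.-1 /\ lead_coef g = 1.
Proof.
pose S : {poly K} := \sum_(i < n) 'X^i.
have ES : 'X^n - 1 = z * S by rewrite subrX1.
have SE : S = \poly_(i < n) 1 by rewrite poly_def; apply: eq_bigr => i _; rewrite scale1r.
have n1 : (0 < n)%N by lia.
have sS : size S = n by rewrite SE size_poly_eq ?oner_neq0.
have lS : lead_coef S = 1 by rewrite lead_coefE sS SE coef_poly ltn_predL n1.
have : root (S - n%:R%:P) 1.
  rewrite rootE hornerD hornerN hornerC horner_sum (eq_bigr (fun _ => 1)).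
    by rewrite sumr_const card_ord subrr.
  by move=> i _; rewrite hornerXn expr1n.
case/factor_theorem => g Eg; exists g.
  have -> : n%:R *: z = z * n%:R%:P by rewrite -mul_polyC mulrC.
  by rewrite ES -mulrBr Eg polyC1 -/z expr2 [g * z]mulrC mulrA.
have lt : (size (- (n%:R%:P : {poly K}))%R < size S)%N.
  by rewrite size_polyN sS (leq_ltn_trans (size_polyC_leq1 _)) //; lia.
have sE : size (g * ('X - 1%:P)) = n by rewrite -Eg size_polyDl.
have lE : lead_coef (g * ('X - 1%:P)) = 1 by rewrite -Eg lead_coefDl.
rewrite lead_coef_Mmonic ?monicXsubC // in lE; split=> //.
have g0 : g != 0 by rewrite -lead_coef_eq0 lE oner_neq0.
by rewrite -sE size_Mmonic ?monicXsubC // size_XsubC addn2 /=.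
Qed.

(** The quadratics with value $-2$ and slope $-2n$ at 1, as for $-2x^n$; the coefficient [c] stays
    free for genericity. *)
Definition quad (c : K) : {poly K} := c *: z ^+ 2 - (2 * n%:R) *: z - 2%:P.

Lemma horner_quad c a : (quad c).[a] = c * (a - 1) ^+ 2 - 2 * n%:R * (a - 1) - 2.
Proof. by rewrite /quad /z !hornerE. Qed.

Lemma deriv_quad c a : (quad c)^`().[a] = 2 * c * (a - 1) - 2 * n%:R.
Proof.
rewrite /quad !derivB derivC !derivZ /z expr2 derivM derivB derivX derivC subr0 !hornerE; ring.
Qed.

Lemma size_quad c : c != 0 -> size (quad c) = 3 /\ lead_coef (quad c) = c.
Proof.
move=> c0.
have sz : size z = 2 by rewrite /z -polyC1 size_XsubC.
have s1 : size (c *: z ^+ 2) = 3%N by rewrite size_scale // /z -polyC1 size_exp_XsubC.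
have lt : (size (- ((2 * n%:R) *: z) - 2%:P)%R < size (c *: z ^+ 2)%R)%N.
  rewrite s1 ltnS (leq_trans (size_polyD _ _)) // !size_polyN geq_max.
  by rewrite (leq_trans (size_scale_leq _ _)) ?sz // (leq_trans (size_polyC_leq1 _)).
rewrite /quad -addrA size_polyDl // s1 lead_coefDl //; split=> //.
by rewrite lead_coefZ lead_coef_exp /z -polyC1 lead_coefXsubC expr1n mulr1.
Qed.

Lemma quadratic_parameter g1 : exists c : K, [/\ c != 0, c + 2 * g1 != 0, (quad c).[0] != 0
  & forall a, a != 1 -> a != 0 -> a * (quad c)^`().[a] = n%:R * (quad c).[a] ->
      (quad c).[a] = 0 \/ (quad c).[a] = - (2 * a ^+ n) -> False].
Proof.
(* With $x=a-1$, the condition $aA'(a)=nA(a)$ becomes $c(2+(2-n)x)=2n(1-n)$, and $A(a)=-2a^n$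
   becomes $c\,x^2=R(x)$. Eliminating $c$ gives $E(x)=0$. Here $E\ne 0$ because $U(x+1)^n$ has
   degree at least $n>2$, whereas $\deg L\le 2$. *)
pose R (x : K) := 2 + 2 * n%:R * x - 2 * (x + 1) ^+ n.
pose U : {poly K} := 2%:P + (2 - n%:R) *: 'X.
pose L : {poly K} := (2 * n%:R * (1 - n%:R)) *: 'X^2 - U * (2%:P + (2 * n%:R) *: 'X).
pose E : {poly K} := L + 2 *: (U * ('X + 1%:P) ^+ n).
have E0 : E != 0.
  apply/negP => /eqP; rewrite /E => /eqP; rewrite addr_eq0 => /eqP EE.
  have U0 : U != 0.
    apply/negP => /eqP U0; have := congr1 (fun p : {poly K} => p.[0]) U0.
    by rewrite /U !hornerE => /eqP; rewrite (negbTE K2).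
  have sC (x y : K) : (size (x%:P + y *: 'X)%R <= 2)%N.
    rewrite (leq_trans (size_polyD _ _)) // geq_max (leq_trans (size_polyC_leq1 _)) //.
    by rewrite (leq_trans (size_scale_leq _ _)) // size_polyX.
  have sL : (size L <= 3)%N.
    rewrite /L (leq_trans (size_polyD _ _)) // size_polyN geq_max.
    rewrite (leq_trans (size_scale_leq _ _)) ?size_polyXn //=.
    rewrite (leq_trans (size_polyMleq _ _)) //.
    rewrite -subn1 leq_subLR; exact: leq_add (sC _ _) (sC _ _).
  have X1 : ('X + 1%:P : {poly K}) ^+ n != 0.
    by rewrite expf_neq0 // -size_poly_gt0 size_XaddC.
  have : (3 < size (2 *: (U * ('X + 1%:P) ^+ n))%R)%N.
    rewrite size_scale // size_mul //.
    have -> : size (('X + 1%:P : {poly K}) ^+ n) = n.+1.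
      by rewrite -[1]opprK polyCN size_exp_XsubC.
    by move: U0; rewrite -size_poly_gt0; move: (size U) => k; lia.
  by rewrite ltnNge -size_polyN -EE sL.
have [rs hrs] := closed_root_seq E0.
(* The first three exclusions are the nonvanishing conditions of the statement. At $c=-n^2/2$ the
   discriminant of $A$ vanishes, which is the alternative $A(a)=A'(a)=0$. The mapped list excludes
   $A(a)=-2a^n$. *)
have [c hc] := closed_avoid ([:: 0; - (2 * g1); 2 - 2 * n%:R; - (n%:R ^+ 2) / 2]
   ++ [seq R x / x ^+ 2 | x <- rs]).
move: hc; rewrite mem_cat !inE !negb_or => /andP[/and4P[c0 c1 c2 c3] hc].
exists c; split=> //; first by rewrite addr_eq0.
  rewrite horner_quad; apply: contra c2 => /eqP h; rewrite -subr_eq0; apply/eqP.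
  by rewrite -h; ring.
move=> a a1 a0; rewrite deriv_quad => E1 hE.
pose x := a - 1; have x0 : x != 0 by rewrite subr_eq0.
have aE : a = x + 1 by rewrite /x subrK.
have Eq : c * (2 + (2 - n%:R) * x) = 2 * n%:R * (1 - n%:R).
  apply: (mulfI x0); apply/eqP; rewrite -subr_eq0; apply/eqP.
  move/eqP: E1; rewrite -subr_eq0 horner_quad -/x {1}aE => /eqP <-.
  by ring.
case: hE => hE.
  move: E1; rewrite hE mulr0 => /eqP; rewrite mulf_eq0 (negbTE a0) /= -/x => /eqP h1.
  have h2 : c * x = n%:R.
    by apply: (mulfI K2); apply/eqP; rewrite -subr_eq0 -[X in _ == X]h1; apply/eqP; ring.
  rewrite horner_quad -/x in hE.
  have h3 : n%:R * x = - 2.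
    have : c * x ^+ 2 - 2 * n%:R * x - 2 = 0 by [].
    rewrite expr2 mulrA h2 => h; apply/eqP; rewrite -subr_eq0 -oppr_eq0 -[X in _ == X]h.
    by apply/eqP; ring.
  case/negP: c3; apply/eqP; apply: (mulIf K2); rewrite divfK //.
  by rewrite expr2 -{1}h2 -mulrA [x * _]mulrC h3; ring.
case/negP: hc; apply/mapP; exists x; last first.
  have x2 : x ^+ 2 != 0 by rewrite expf_neq0.
  apply: (mulIf x2); rewrite divfK // /R -aE.
  rewrite horner_quad -/x in hE; apply/eqP; rewrite -subr_eq0.
  move/eqP: hE; rewrite -subr_eq0 => /eqP <-; apply/eqP; ring.
have hR : c * x ^+ 2 = 2 + 2 * n%:R * x - 2 * a ^+ n.
  rewrite horner_quad -/x in hE; apply/eqP; rewrite -subr_eq0.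
  by move/eqP: hE; rewrite -subr_eq0 => /eqP <-; apply/eqP; ring.
have Ev : E.[x] = 2 * n%:R * (1 - n%:R) * x ^+ 2 - (2 + (2 - n%:R) * x) * (2 + 2 * n%:R * x)
    + 2 * ((2 + (2 - n%:R) * x) * a ^+ n).
  by rewrite /E /L /U !hornerE -aE.
apply: hrs; rewrite rootE Ev -Eq.
have -> : c * (2 + (2 - n%:R) * x) * x ^+ 2 = (2 + (2 - n%:R) * x) * (c * x ^+ 2) by ring.
by rewrite hR; apply/eqP; ring.
Qed.

Lemma quadratic_size_bound k : (2 * k.-1 <= n)%N -> (k.+1 <= n)%N.
Proof. by lia. Qed.

Lemma quadratic_curve : exists f s t : {poly K},
  [/\ f \is monic, size f = n.+1, no_repeated_roots f
    & [/\ s ^+ 2 - t ^+ 2 * f = 'X^(2 * n), s.[0] != 0, (size t).-1 = 1%N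
    & forall (u : {poly K}) (k k' : K), k != 0 -> (2 * (size u).-1 <= n)%N ->
        u ^+ 2 - k *: f <> k' *: 'X^n]].
Proof.
have n0 : (0 < n)%N by lia.
have [g Eg [sg lg]] := tangent_quotient.
have [c [c0 cg A0 hc]] := quadratic_parameter g.[1].
have [sA lA] := size_quad c0; set A := quad c in A0 hc sA lA *.
have A1 : A.[1] = - 2 by rewrite horner_quad subrr; ring.
pose B := c%:P + 2 *: g; pose f0 := A * B.
have g0 : g != 0 by rewrite -lead_coef_eq0 lg oner_neq0.
have sg2 : size (2 *: g) = n.-1 by rewrite size_scale.
have ltB : (size (c%:P : {poly K})%R < size (2 *: g)%R)%N.
  by rewrite sg2 (leq_ltn_trans (size_polyC_leq1 _)) //; lia.
have sB : size B = n.-1 by rewrite /B addrC size_polyDl.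
have lB : lead_coef B = 2 by rewrite /B addrC lead_coefDl // lead_coefZ lg mulr1.
have B1 : B.[1] = c + 2 * g.[1] by rewrite /B !hornerE.
have EAB : A + 2 *: 'X^n = z ^+ 2 * B.
  have -> : z ^+ 2 * B = c *: z ^+ 2 + 2 *: (z ^+ 2 * g).
    by rewrite /B mulrDr [_ * c%:P]mulrC mul_polyC -scalerAr.
  by rewrite -Eg /A /quad -!mul_polyC !polyCM !polyC_natr; ring.
pose s := A + 'X^n.
have E0 : z ^+ 2 * f0 = s ^+ 2 - 'X^(2 * n).
  by rewrite /f0 mulrCA -EAB mulnC exprM -mul_polyC polyC_natr /s; ring.
have An0 : A != 0 by rewrite -size_poly_gt0 sA.
have Bn0 : B != 0 by rewrite -lead_coef_eq0 lB.
have sf0 : size f0 = n.+1 by rewrite size_mul // sA sB -[in RHS](prednK n0).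
have lf0 : lead_coef f0 = c * 2 by rewrite lead_coefM lA lB.
have c2 : c * 2 != 0 by rewrite mulf_neq0.
(* A square root of the leading coefficient of $f_0$, put into $t=yz$, makes $f$ monic. *)
have [y hy] := closed_dth_root (c * 2) (isT : (0 < 2)%N).
have y0 : y != 0 by apply: contraNneq c2 => y0; rewrite -hy y0 expr0n.
have s0 : s.[0] != 0 by rewrite /s hornerD hornerXn expr0n gtn_eqF // addr0.
exists ((c * 2)^-1 *: f0), s, (y *: z); split.
- by apply/monicP; rewrite lead_coefZ lf0 mulVf.
- by rewrite size_scale // invr_eq0.
- move=> a; rewrite dvdpZr ?invr_eq0 //; apply/negP => ha.
  have [a1|a1] := eqVneq a 1.
    have [/rootP] := double_root ha; rewrite a1 /f0 hornerM A1 B1 => /eqP.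
    by rewrite mulf_eq0 oppr_eq0 (negbTE K2) (negbTE cg).
  have := dvdp_mull (z ^+ 2) ha; rewrite E0.
  move=> /(double_root_norm (isT : (0 < 2)%N) n0 K2 s0)[a0 E1 E2].
  apply: (hc a a1 a0).
    have Ea : a ^+ n = a * a ^+ n.-1 by rewrite -exprS prednK.
    move: E2; rewrite /s derivD derivXn !hornerE !hornerMn !hornerE -mulr_natl mulrDr mulrDr.
    by rewrite [a * (n%:R * _)]mulrCA -Ea => /addIr.
  have : A.[a] * (A.[a] + 2 * a ^+ n) = 0.
    have sa : s.[a] = A.[a] + a ^+ n by rewrite /s hornerD hornerXn.
    move/eqP: E1; rewrite -subr_eq0 sa mulnC exprM => /eqP <-; ring.
  by move/eqP; rewrite mulf_eq0 addr_eq0 => /orP[/eqP|/eqP]; [left | right].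
split=> //.
- rewrite exprZn hy -scalerAl -scalerAr scalerA divff // scale1r E0.
  by rewrite opprB addrC subrK.
- by rewrite size_scale // /z -polyC1 size_XsubC.
move=> u k k' k0 du Eu.
have [dl hdl] := closed_dth_root (k / (c * 2)) (isT : (0 < 2)%N).
have dl0 : dl != 0.
  apply: contraTneq k0 => dl0; move/eqP: hdl; rewrite dl0 expr0n eq_sym mulf_eq0 invr_eq0.
  by rewrite (negbTE c2) orbF negbK.
(* Let $\delta$ be [dl], so that $kf=\delta^2f_0$. Multiplying the relation by $z^2$ and using
   $z^2f_0=A^2+2Ax^n$ shows that $x^n$ divides $(zu)^2-\delta^2A^2$. The two factors differ by
   $2\delta A$ and $A(0)\ne 0$, so one of them takes all of $x^n$. But both have degree below $n$
   and are nonzero, as their values at 1 are $\mp 2\delta$. *)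
pose P e := z * u + e *: A.
have EP : P dl * P (- dl) = 'X^n * (k' *: z ^+ 2 + (2 * dl ^+ 2) *: A).
  have Eu2 : u ^+ 2 = k' *: 'X^n + (dl ^+ 2) *: f0.
    by rewrite -Eu hdl scalerA subrK.
  transitivity (z ^+ 2 * u ^+ 2 - (dl ^+ 2) *: A ^+ 2).
    by rewrite /P -!mul_polyC polyCN polyC_exp; ring.
  rewrite Eu2 mulrDr -[z ^+ 2 * (_ *: f0)]scalerAr E0 mulnC exprM /s.
  by rewrite -!mul_polyC [(2 * _)%:P]polyCM polyC_natr; ring.
have sP e : (size (P e) <= n)%N.
  rewrite (leq_trans (size_polyD _ _)) // geq_max; apply/andP; split.
    rewrite (leq_trans (size_polyMleq _ _)) // /z -polyC1 size_XsubC /=.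
    exact: quadratic_size_bound.
  by rewrite (leq_trans (size_scale_leq _ _)) // sA.
have P1 e : e != 0 -> P e != 0.
  move=> e0; apply: contraNneq e0 => Pe.
  have := congr1 (fun p : {poly K} => p.[1]) Pe.
  rewrite /P hornerD hornerZ A1 hornerM hornerD hornerN hornerX hornerC subrr mul0r add0r horner0 => /eqP.
  by rewrite mulf_eq0 oppr_eq0 (negbTE K2) orbF.
have ndl0 : - dl != 0 by rewrite oppr_eq0.
have hP e : e != 0 -> ~ 'X^n %| P e.
  by move=> e0 /dvdp_leq - /(_ (P1 e e0)); rewrite size_polyXn ltnNge sP.
have hdv : 'X^n %| P dl * P (- dl) by rewrite EP dvdp_mulr.
have [r1|r1] := boolP (root (P dl) 0); last first.
  apply: (hP _ ndl0); move: hdv; rewrite Gauss_dvdpr //.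
  by apply: coprimep_expl; rewrite coprimep_sym coprimepX.
have r2 : ~~ root (P (- dl)) 0.
  apply/negP => /rootP r2; move/rootP: r1 => r1.
  have : (2 * dl) * A.[0] = (P dl).[0] - (P (- dl)).[0].
    by rewrite /P !hornerE; ring.
  by rewrite r1 r2 subrr => /eqP; rewrite !mulf_eq0 (negbTE K2) (negbTE dl0) (negbTE A0).
apply: (hP _ dl0); move: hdv; rewrite Gauss_dvdpl //.
by apply: coprimep_expl; rewrite coprimep_sym coprimepX.
Qed.

End QuadraticCurve.

(** * Transfer to the concrete field of fractions, and the theorem *)

Lemma tofrac_inj (R : idomainType) : injective (@FracField.tofrac R).
Proof. by move=> p q /eqP; rewrite tofrac_eq => /eqP. Qed.

Lemma tofrac_quotient (R : idomainType) (q : {fraction R}) :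
  exists u : R * R, q = FracField.tofrac u.1 / FracField.tofrac u.2 /\ u.2 != 0.
Proof.
exists (\n_(repr q), \d_(repr q)); split; last exact: denom_ratioP.
have hd : FracField.tofrac \d_(repr q) != 0 by rewrite tofrac_eq0 denom_ratioP.
apply: (mulIf hd); rewrite divfK //.
move: (reprK q); move: (repr q) => x <-; rewrite /FracField.tofrac; unlock.
rewrite -[LHS]FracField.pi_mul; apply/eqmodP => /=.
rewrite FracField.equivfE /FracField.mulf !numden_Ratio ?oner_neq0 ?mulf_neq0 ?denom_ratioP //=.
by rewrite !mulr1 mulrC.
all: exact: oner_neq0.
Qed.

Definition frac_model (R : idomainType) : fraction_model R :=
  @FractionModel R {fraction R} (@FracField.tofrac R) (@tofrac_inj R) (@tofrac_quotient R).

(** For [frac_model] the abstract notions unfold to those of the statement, so both sides are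
    convertible. *)
Lemma point_has_orderE (K : closedFieldType) (f : {poly K}) (d m : nat)
    (Q : {poly {fraction {poly K}}} -> option int) :
  point_has_order f d Q m <->
  [/\ @gplace K (frac_model {poly K}) f d Q, (0 < m)%N,
      exists h, @has_div K (frac_model {poly K}) f d h Q m
    & forall k, (0 < k < m)%N -> ~ exists h, @has_div K (frac_model {poly K}) f d h Q k].
Proof. exact: iff_refl. Qed.

Lemma curve_existence (K : closedFieldType) (d n l : nat) :
  (1 < d)%N -> (d < n)%N -> coprime n d -> d%:R != 0 :> K -> (n < d * l)%N ->
  (d * l <= n + l)%N ->
  ((n + l - d * l = 0)%N -> l%:R != 0 :> K) ->
  ((0 < n + l - d * l)%N -> (n + l - d * l)%:R != 0 :> K) ->
  exists f s t : {poly K},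
  [/\ f \is monic, size f = n.+1, no_repeated_roots f
    & [/\ s ^+ d - t ^+ d * f = 'X^(d * l), s.[0] != 0, (d * (size t).-1 + n < d * l)%N,
      forall k, (2 * k <= d * l)%N -> (k <= n)%N
    & (2 * n <= d * l)%N -> forall (u : {poly K}) (c c' : K), c != 0 ->
        (d * (size u).-1 <= n)%N -> u ^+ d - c *: f <> c' *: 'X^n]].
Proof.
move=> d1 dn cop dK nl ln c0 ce.
have dlE : (d * l = l + d.-1 * l)%N by case: d d1 {dn cop dK nl ln c0 ce} => // d' _; rewrite mulSn.
have l0 : (0 < l)%N by case: (l) nl; rewrite ?muln0.
have dll : (l <= d.-1 * l)%N by rewrite leq_pmull //; lia.
have hk k : (2 * k <= d * l)%N -> (k <= n)%N.
  by move: dlE ln dll; move: (d * l)%N (d.-1 * l)%N => x y; lia.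
have [/andP[/eqP d2 /eqP lE]|special] := boolP ((d == 2%N) && (l == n)).
  rewrite d2 in dn cop dK nl ln c0 ce *; rewrite lE in nl c0 ce *.
  have Kn : n%:R != 0 :> K by apply: c0; lia.
  have [f [s [t [h1 h2 h3 [h4 h5 h6 h7]]]]] := quadratic_curve dn dK Kn.
  exists f, s, t; split=> //; split=> //; first by rewrite h6; lia.
  by move=> k; lia.
pose e := (n + l - d * l)%N.
have el : (e < l)%N by rewrite /e; move: nl; move: (d * l)%N => x; lia.
have [f [s [t [h1 h2 h3 [h4 h5 h6]]]]] := general_curve d1 l0 el dK c0 ce.
have nE : (e + d.-1 * l)%N = n.
  by rewrite /e; move: dlE ln; move: (d * l)%N (d.-1 * l)%N => x y; lia.
exists f, s, t; split=> //; first by rewrite h2 nE.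
split=> //; first by rewrite h6 muln0.
(* From $2n\le dl\le n+l$ follow $n\le l$ and $(d-1)l\le n$, hence $d=2$ and $l=n$. Outside the
   special case the clause is therefore vacuous. *)
move=> hn; case/negP: special.
have nl' : (n <= l)%N by move: dlE ln hn; move: (d * l)%N (d.-1 * l)%N => x y; lia.
have d2 : d = 2%N.
  apply/eqP; rewrite eqn_leq d1 andbT leqNgt; apply/negP => d3.
  have h : (2 * l <= d.-1 * l)%N by rewrite leq_mul2r -ltnS prednK ?d3 ?orbT // ltnW.
  by move: h dlE ln; move: (d * l)%N (d.-1 * l)%N => x y; lia.
rewrite d2 eqxx /=; apply/eqP.
by move: ln; rewrite d2; lia.
Qed.

Theorem theorem5p1 (K : closedFieldType) (d n : nat)
  (hd : (1 < d)%N) (hdn : (d < n)%N) (hcop : coprime n d)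
  (hchar : forall p : nat, p \in [pchar K] -> ~~ (p %| d)%N) :
  forall m : nat, (n < m)%N ->
  (* (a) *)
  ((m = d * ((n + d) %/ d))%N -> reachable K n d m ->
     (n%:Z - m%:Z + (m %/ d)%N%:Z = n%:Z - (d.-1)%:Z * ((n + d) %/ d)%N%:Z)
     /\ 0 <= n%:Z - m%:Z + (m %/ d)%N%:Z)
  /\
  (* (b) *)
  ((d %| m)%N -> (m <= n + m %/ d)%N ->
     ([pchar K] =i pred0 \/
      exists p : nat, [/\ p \in [pchar K],
         (n + m %/ d - m = 0)%N -> ~~ (p %| m %/ d)%N
       & (0 < n + m %/ d - m)%N -> ~~ (p %| n + m %/ d - m)%N]) ->
     reachable K n d m).
Proof.
have d0 : (0 < d)%N := ltnW hd.
have dK : d%:R != 0 :> K.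
  apply/negP => dK0; have [p hp] := natf0_pchar d0 dK0.
  by have := hchar p hp; rewrite (dvdn_pcharf hp) dK0.
move=> m nm; split.
- move=> mE [m1 [f [fmon sf fnr [Q /point_has_orderE[QP _ hdiv hmin]]]]].
  set k0 := ((n + d) %/ d)%N in mE *.
  have mn : (m < n + d)%N.
    (* Only equality with $n+d$ has to be excluded; it would give $d\mid n$, against coprimality and
       $d>1$. *)
    rewrite mE mulnC ltn_neqAle leq_trunc_div andbT; apply/eqP => E.
    have : (d %| n + d)%N by rewrite -E dvdn_mull.
    rewrite dvdn_addl // => dvn; move: hcop.
    by rewrite /coprime; move/gcdn_idPr: dvn => ->; case: eqP hd => // ->.
  have hle := torsion_degree_bound hd dK hcop sf fnr QP hdn mE nm mn hdiv hmin.
  have dkE : (m = k0 + d.-1 * k0)%N by rewrite mE -{1}(prednK d0) mulSn.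
  have mdE : (m %/ d = k0)%N by rewrite mE mulKn.
  rewrite mdE dkE -PoszM; move: hle; move: (d.-1 * k0)%N => x; lia.
- move=> /dvdnP[l]; rewrite mulnC => mE; rewrite mE mulKn // => ln hK.
  rewrite mE in nm.
  have c0 : (n + l - d * l = 0)%N -> l%:R != 0 :> K.
    move=> e0; case: hK => [hp|[p [hp h _]]].
      by rewrite (pcharf0P _).1 //; case: (l) nm; rewrite ?muln0.
    by rewrite -(dvdn_pcharf hp) h.
  have ce : (0 < n + l - d * l)%N -> (n + l - d * l)%:R != 0 :> K.
    move=> e0; case: hK => [hp|[p [hp _ h]]].
      by rewrite (pcharf0P _).1 // -lt0n.
    by rewrite -(dvdn_pcharf hp) h.
  have [f [s [t [h1 h2 h3 [h4 h5 h6 h7 h8]]]]] := curve_existence hd hdn hcop dK nm ln c0 ce.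
  have m1 : (1 < d * l)%N by lia.
  split=> //; exists f; split=> //.
  have [Q hQ] := point_order_exact (frac_model {poly K}) hd dK hcop h2 h3 hdn m1 h4 h5 h6 h7 h8.
  by exists Q; apply/point_has_orderE.
Qed.
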